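(* Let $(H\xrightarrow{\partial}G,\alpha)$ be a crossed module of Lie groups and let $\mathcal G_\bullet$ be the associated strict Lie 2-group. Then the following are 2-representations $B\mathcal G_\bullet\to2\mathsf{Vect}$ of $\mathcal G_\bullet$. (1) $\mathcal F=(F,F^2,F^0)$: the unique object $*$ of $B\mathcal G_\bullet$ is sent to $\mathsf{Rep}^{\mathcal G_\bullet}$; each $g\in G$ is sent to the functor $F_g$ with, for an object $\rho$ with fibres $V_x=\rho(x)$, $F_g(\rho):x\mapsto\rho(xg)$, $(x\xrightarrow{(x,h)}y)\mapsto\big(V_{xg}\xrightarrow{\rho(xg,h)}V_{yg}\big)$, and, for a morphism $f:\rho\Rightarrow\rho'$, $F_g(f)_x=f_{xg}$; each arrow $(g,h)$ is sent to the natural transformation $F_{(g,h)}$ with $F_{(g,h)}(\rho)_x:\rho(xg)\to\rho(x\,\partial(h)\,g)$, $v\mapsto\rho\big(xg,\alpha(x)^{-1}(h)\big)(v)$; and the structure 2-morphisms $F^2$ and $F^0$ are trivial (identities). (2) $\mathcal F_{tr}=(F_{tr},F^2_{tr},F^0_{tr})$: the unique object $*$ is sent to $\mathsf{Rep}^{\mathcal G_\bullet}_{tr}$; each $g\in G$ is sent to the functor $F_{tr,g}$ with, for an object $\rho$ on the trivial bundle with fibre $V$, $F_{tr,g}(\rho):x\mapsto V$, $(x\xrightarrow{(x,h)}y)\mapsto\big(V\xrightarrow{\rho(xg,h)}V\big)$, and, for a morphism $f:\rho\Rightarrow\rho'$, $F_{tr,g}(f)_x=f_{xg}$; each arrow $(g,h)$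 is sent to the natural transformation $F_{tr,(g,h)}$ with $F_{tr,(g,h)}(\rho)_x:\rho(xg)\to\rho(x\,\partial(h)\,g)$, $v\mapsto\rho\big(xg,\alpha(x)^{-1}(h)\big)(v)$; and the structure 2-morphisms $F^2_{tr}$ and $F^0_{tr}$ are trivial (identities).
   Context: $k$ is a field of characteristic zero (typically $\mathbb R$ or $\mathbb C$). A crossed module of Lie groups $(H\xrightarrow{\partial}G,\alpha)$ consists of a Lie group morphism $\partial:H\to G$ and a right action of $G$ on $H$, i.e. a Lie group morphism $\alpha:G^{op}\to\mathrm{Aut}(H)$, such that $\partial(\alpha(g)h)=g^{-1}\partial(h)g$ and $\alpha(\partial(h))h'=h^{-1}h'h$. The associated strict Lie 2-group $\mathcal G_\bullet$, with underlying Lie groupoid $H\ltimes G\rightrightarrows G$, has object manifold $G$ and arrows $(g_1,h)$, $g_1\in G$, $h\in H$, with source $g_1$ and target $\partial(h)g_1$; vertical composition $(g_2,h_2)\cdot_v(g_1,h_1)=(g_1,h_2h_1)$ for $g_2=\partial(h_1)g_1$; and horizontal product given by multiplication in $G$ on objects and $(g_1,h)\cdot_h(g_1',h')=(g_1g_1',\,h\,\alpha(g_1^{-1})(h'))$ on arrows. $B\mathcal G_\bullet$ is the (strict) 2-category with one object $*$, hom-category $\mathcal G_\bullet$ and horizontal composition the horizontal product. $2\mathsf{Vect}$ is the strict 2-category of $k$-prelinear categories (hom-sets are $k$-vector spaces, composition $k$-bilinear), $k$-linear functors and natural transformations. A 2-representation is a pseudofunctor $B\mathcal G_\bullet\to2\mathsf{Vect}$,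 with structure isomorphisms $F^2$ (for composition) and $F^0$ (for units). $\mathsf{Rep}^{\mathcal G_\bullet}$ is the category of representations of the underlying Lie groupoid of $\mathcal G_\bullet$: objects are vector bundles $V\to G$ with a Lie groupoid morphism $\rho$ from $\mathcal G_\bullet$ to the groupoid of linear isomorphisms between fibres of $V$ (so $\rho(x)=V_x$); morphisms are $\mathcal G_\bullet$-equivariant bundle maps. $\mathsf{Rep}^{\mathcal G_\bullet}_{tr}$ is its full subcategory of objects whose bundle is trivial, of the form $V\times G$ with $V$ a fixed vector space. *)

(* Defs.v *)
(* The scalar field k is a finite field extension of the real field R, hence R
   itself or a copy of the complex numbers: these are the characteristic-zero
   fields over which smooth vector bundles on real Lie groups make sense. *)
From HB Require Import structures.
From mathcomp Require Import all_boot all_order all_algebra all_field.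
From mathcomp Require Import all_classical all_reals all_analysis.

Set Implicit Arguments.
Unset Strict Implicit.
Unset Printing Implicit Defensive.

Import Order.TTheory GRing.Theory Num.Theory numFieldNormedType.Exports.

Local Open Scope classical_set_scope.
Local Open Scope ring_scope.

(* Class C^n near x: all iterated partial derivatives up to order n exist (and
   are differentiable, for those of order < n, or continuous, at order n) on a
   neighbourhood of x. *)
Fixpoint Cn (R : realType) d (n : nat) (f : 'rV[R]_d -> R) (x : 'rV[R]_d) :=
  if n is m.+1 then
    (\forall y \near x, differentiable f y) /\
    forall j, Cn m (fun y => 'D_('e_j) f y) x
  else \forall y \near x, {for y, continuous f}.

(* The neighbourhood of x may depend on n; on an open set of points x this is
   the usual notion of a C^oo function. *)
Definition smooth_at (R : realType) d (f : 'rV[R]_d -> R) (x : 'rV[R]_d) :=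
  forall n, Cn n f x.

Lemma near_eq_differentiable (R : numFieldType) (V W : normedModType R)
    (f g : V -> W) (x : V) :
  (\near x, f x = g x) -> differentiable f x -> differentiable g x.
Proof.
move=> fg df; apply/diff_locallyP.
have fgx := nbhs_singleton fg.
have H2 : \forall h \near 0, f (h + x) = g (h + x).
  by move: fg; rewrite (near_shift 0) subr0.
have dg : g \o shift x = cst (g x) + 'd f x +o_ 0 id.
  apply/eqaddoP => e e0; have := diff_locally df => /eqaddoP/(_ e e0) H.
  near=> h; rewrite (_ : (_ - _) h = g (h + x) - (g x + 'd f x h)) //.
  rewrite -(near H2 h)// -fgx; near: h; exact: H.
have := diff_unique (diff_continuous df) dg => ->.
by split => //; apply: diff_continuous.
Unshelve. all: by end_near. Qed.

Lemma near_eq_continuous (T U : topologicalType) (f g : T -> U) (x : T) :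
  (\near x, f x = g x) -> {for x, continuous f} -> {for x, continuous g}.
Proof.
move=> fg cf; rewrite /prop_for /continuous_at -(nbhs_singleton fg) => A /cf fA.
by apply: filterS2 fg fA => y /= ->.
Qed.

Section SmoothAt.
Variables (R : realType) (d : nat).
Implicit Types (f g : 'rV[R]_d -> R) (x : 'rV[R]_d).

Lemma Cn_near_eq n f g x : (\near x, f x = g x) -> Cn n f x -> Cn n g x.
Proof.
elim: n f g => [|n IH] f g /near_join fg /=.
  move=> cf; near=> y.
  have fy : \near y, f y = g y by near: y.
  have cfy : {for y, continuous f} by near: y.
  exact: near_eq_continuous fy cfy.
case=> df Df; split.
  near=> y; apply: (near_eq_differentiable (f := f)); near: y => //.
move=> j; apply: IH (Df j).
by near=> y; apply: near_eq_derive; near: y.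
Unshelve. all: by end_near. Qed.

Lemma Cn_pred n f x : Cn n.+1 f x -> Cn n f x.
Proof.
elim: n f => [|n IH] f [df Df].
  by apply: filterS df => y; exact: differentiable_continuous.
by split=> // j; apply: IH; exact: Df.
Qed.

Lemma Cn_cst n (a : R) x : Cn n (cst a) x.
Proof.
elim: n a => [|n IH] a /=.
  by near=> y; exact: cst_continuous.
split=> [|j]; first by near=> y; exact: differentiable_cst.
apply: (Cn_near_eq (f := cst 0)) (IH 0).
by near=> y; rewrite derive_cst.
Unshelve. all: by end_near. Qed.

Lemma CnD n f g x : Cn n f x -> Cn n g x -> Cn n (f \+ g) x.
Proof.
elim: n f g => [|n IH] f g /=.
  move=> cf cg; near=> y.
  have cfy : {for y, continuous f} by near: y.
  have cgy : {for y, continuous g} by near: y.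
  exact: continuousD.
move=> [df Df] [dg Dg]; split.
  by near=> y; apply: differentiableD; near: y.
move=> j; apply: Cn_near_eq (IH _ _ (Df j) (Dg j)).
by near=> y; rewrite /= deriveD//; apply: diff_derivable; near: y.
Unshelve. all: by end_near. Qed.

Lemma CnM n f g x : Cn n f x -> Cn n g x -> Cn n (f \* g) x.
Proof.
elim: n f g => [|n IH] f g.
  move=> cf cg; near=> y.
  have cfy : {for y, continuous f} by near: y.
  have cgy : {for y, continuous g} by near: y.
  exact: continuousM.
move=> Hf Hg; move: (Hf) (Hg) => [df Df] [dg Dg]; split.
  by near=> y; apply: differentiableM; near: y.
move=> j.
have := CnD (IH _ _ (Cn_pred Hf) (Dg j)) (IH _ _ (Cn_pred Hg) (Df j)).
apply: Cn_near_eq.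
by near=> y; rewrite /= deriveM//; apply: diff_derivable; near: y.
Unshelve. all: by end_near. Qed.
End SmoothAt.

(* A chart of M with values in R^d: a domain, a coordinate map and its inverse;
   only the values of cfun on cdom and of cinv on the image are meaningful. *)
Record chart (R : realType) (M : Type) (d : nat) := Chart {
  cdom : set M;
  cfun : M -> 'rV[R]_d;
  cinv : 'rV[R]_d -> M }.

Definition is_chart (R : realType) (M : topologicalType) d (c : chart R M d) :=
  [/\ open (cdom c), open (cfun c @` cdom c),
      {in cdom c, cancel (cfun c) (cinv c)},
      {in cdom c, continuous (cfun c)} &
      {in cfun c @` cdom c, continuous (cinv c)}].

(* Smoothness of f with respect to atlases A and B, read in all charts. *)
Definition smooth_map (R : realType) (M N : topologicalType) m n
    (A : set (chart R M m)) (B : set (chart R N n)) (f : M -> N) :=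
  continuous f /\
  forall c c' p j, A c -> B c' -> cdom c p -> cdom c' (f p) ->
    smooth_at (fun u => cfun c' (f (cinv c u)) 0 j) (cfun c p).

Definition prod_chart (R : realType) (M N : Type) m n
    (c : chart R M m) (c' : chart R N n) : chart R (M * N) (m + n) :=
  {| cdom := cdom c `*` cdom c';
     cfun := fun p => row_mx (cfun c p.1) (cfun c' p.2);
     cinv := fun u => (cinv c (lsubmx u), cinv c' (rsubmx u)) |}.

Definition prod_atlas (R : realType) (M N : Type) m n
    (A : set (chart R M m)) (B : set (chart R N n)) :
    set (chart R (M * N) (m + n)) :=
  [set prod_chart c c' | c in A & c' in B].

HB.mixin Record isManifold (R : realType) (d : nat) M of Topological M := {
  atlas : set (chart R M d);
  manifold_hausdorff : hausdorff_space M;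
  manifold_second_countable : @second_countable M;
  atlas_chart : forall c, atlas c -> is_chart c;
  atlas_cover : forall p, exists2 c, atlas c & cdom c p;
  atlas_compat : smooth_map atlas atlas idfun }.

#[short(type="manifoldType")]
HB.structure Definition Manifold (R : realType) (d : nat) :=
  {M of Topological M & isManifold R d M}.

Arguments atlas {R d} M : rename.

HB.mixin Record isLieGroup (R : realType) (d : nat) G
    of Manifold R d G & Group G := {
  mulg_smooth : smooth_map (prod_atlas (atlas G) (atlas G)) (atlas G)
                  (fun p : G * G => (p.1 * p.2)%g);
  invg_smooth : smooth_map (atlas G) (atlas G) (fun x : G => x^-1%g) }.

#[short(type="lieGroupType")]
HB.structure Definition LieGroup (R : realType) (d : nat) :=
  {G of Manifold R d G & Group G & isLieGroup R d G}.

(* The group of automorphisms of H enters only through the action map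
   (g, h) |-> xact g h of G on H, required to be smooth on G * H. *)
Record crossed_module (R : realType) (dG dH : nat)
    (G : lieGroupType R dG) (H : lieGroupType R dH) := CrossedModule {
  bd : H -> G;
  xact : G -> H -> H;
  bdM : {morph bd : h h' / (h * h')%g};
  bd_smooth : smooth_map (atlas H) (atlas G) bd;
  xactM : forall g, {morph xact g : h h' / (h * h')%g};
  xact1 : forall h, xact 1%g h = h;
  xact_mul : forall g g' h, xact (g * g')%g h = xact g' (xact g h);
  xact_smooth : smooth_map (prod_atlas (atlas G) (atlas H)) (atlas H)
                  (fun p : G * H => xact p.1 p.2);
  bd_xact : forall g h, bd (xact g h) = (g^-1 * bd h * g)%g;
  peiffer : forall h h', xact (bd h) h' = (h^-1 * h' * h)%g }.

Record two_data := TwoData {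
  cell0 :> Type;
  cell1 : cell0 -> cell0 -> Type;
  cell2 : forall a b, cell1 a b -> cell1 a b -> Type;
  id1 : forall a, cell1 a a;
  comp1 : forall a b c, cell1 b c -> cell1 a b -> cell1 a c;
  id2 : forall a b (f : cell1 a b), cell2 f f;
  vcomp : forall a b (f g h : cell1 a b),
    cell2 g h -> cell2 f g -> cell2 f h;
  hcomp : forall a b c (g g' : cell1 b c) (f f' : cell1 a b),
    cell2 g g' -> cell2 f f' -> cell2 (comp1 g f) (comp1 g' f') }.

Arguments cell1 {t}.
Arguments cell2 {t a b}.
Arguments id1 {t}.
Arguments comp1 {t a b c}.
Arguments id2 {t a b}.
Arguments vcomp {t a b f g h}.
Arguments hcomp {t a b c g g' f f'}.

(* The identity 2-cell between two equal 1-cells. *)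
Definition eq2 (C : two_data) (a b : C) (f g : cell1 a b) (e : f = g) :
    cell2 f g :=
  match e in _ = g' return cell2 f g' with erefl => id2 f end.

Record is_two_cat (C : two_data) : Prop := IsTwoCat {
  comp1A : forall (a b c d : C) (h : cell1 c d) (g : cell1 b c) (f : cell1 a b),
    comp1 h (comp1 g f) = comp1 (comp1 h g) f;
  comp1_1l : forall (a b : C) (f : cell1 a b), comp1 (id1 b) f = f;
  comp1_1r : forall (a b : C) (f : cell1 a b), comp1 f (id1 a) = f;
  vcompA : forall (a b : C) (f g h i : cell1 a b)
    (z : cell2 h i) (y : cell2 g h) (x : cell2 f g),
    vcomp z (vcomp y x) = vcomp (vcomp z y) x;
  vcomp_1l : forall (a b : C) (f g : cell1 a b) (x : cell2 f g),
    vcomp (id2 g) x = x;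
  vcomp_1r : forall (a b : C) (f g : cell1 a b) (x : cell2 f g),
    vcomp x (id2 f) = x;
  hcomp_id : forall (a b c : C) (g : cell1 b c) (f : cell1 a b),
    hcomp (id2 g) (id2 f) = id2 (comp1 g f);
  interchange : forall (a b c : C) (g g' g'' : cell1 b c)
    (f f' f'' : cell1 a b) (y' : cell2 g' g'') (y : cell2 g g')
    (x' : cell2 f' f'') (x : cell2 f f'),
    hcomp (vcomp y' y) (vcomp x' x) = vcomp (hcomp y' x') (hcomp y x);
  hcompA : forall (a b c d : C) (h h' : cell1 c d) (g g' : cell1 b c)
    (f f' : cell1 a b) (z : cell2 h h') (y : cell2 g g') (x : cell2 f f'),
    vcomp (eq2 (comp1A h' g' f')) (hcomp z (hcomp y x)) =
    vcomp (hcomp (hcomp z y) x) (eq2 (comp1A h g f));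
  hcomp_1l : forall (a b : C) (f f' : cell1 a b) (x : cell2 f f'),
    vcomp (eq2 (comp1_1l f')) (hcomp (id2 (id1 b)) x) =
    vcomp x (eq2 (comp1_1l f));
  hcomp_1r : forall (a b : C) (f f' : cell1 a b) (x : cell2 f f'),
    vcomp (eq2 (comp1_1r f')) (hcomp x (id2 (id1 a))) =
    vcomp x (eq2 (comp1_1r f)) }.

Record two_cat := TwoCat {
  two_cat_data :> two_data;
  two_catP : is_two_cat two_cat_data }.

Definition invertible2 (C : two_data) (a b : C) (f g : cell1 a b)
    (x : cell2 f g) :=
  exists y : cell2 g f, vcomp y x = id2 f /\ vcomp x y = id2 g.

(* (P0, P1, P2) with structure 2-cells Pm (for composition) and Pu (for units)
   is a pseudofunctor from C to D. *)
Record is_pseudofunctor (C D : two_cat) (P0 : C -> D)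
    (P1 : forall a b, cell1 a b -> cell1 (P0 a) (P0 b))
    (P2 : forall a b (f g : cell1 a b), cell2 f g -> cell2 (P1 a b f) (P1 a b g))
    (Pm : forall a b c (g : cell1 b c) (f : cell1 a b),
        cell2 (comp1 (P1 b c g) (P1 a b f)) (P1 a c (comp1 g f)))
    (Pu : forall a, cell2 (id1 (P0 a)) (P1 a a (id1 a))) : Prop :=
  IsPseudofunctor {
  pf_id2 : forall a b (f : cell1 a b), P2 a b f f (id2 f) = id2 (P1 a b f);
  pf_vcomp : forall a b (f g h : cell1 a b) (y : cell2 g h) (x : cell2 f g),
    P2 a b f h (vcomp y x) = vcomp (P2 a b g h y) (P2 a b f g x);
  pf_mult_inv : forall a b c (g : cell1 b c) (f : cell1 a b),
    invertible2 (Pm a b c g f);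
  pf_unit_inv : forall a, invertible2 (Pu a);
  pf_mult_nat : forall a b c (g g' : cell1 b c) (f f' : cell1 a b)
    (y : cell2 g g') (x : cell2 f f'),
    vcomp (P2 a c _ _ (hcomp y x)) (Pm a b c g f) =
    vcomp (Pm a b c g' f') (hcomp (P2 b c g g' y) (P2 a b f f' x));
  pf_assoc : forall a b c d (h : cell1 c d) (g : cell1 b c) (f : cell1 a b),
    vcomp (P2 a d _ _ (eq2 (comp1A (two_catP C) h g f)))
      (vcomp (Pm a c d h (comp1 g f)) (hcomp (id2 (P1 c d h)) (Pm a b c g f))) =
    vcomp (Pm a b d (comp1 h g) f)
      (vcomp (hcomp (Pm b c d h g) (id2 (P1 a b f)))
        (eq2 (comp1A (two_catP D) (P1 c d h) (P1 b c g) (P1 a b f))));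
  pf_unit_l : forall a b (f : cell1 a b),
    vcomp (P2 a b _ _ (eq2 (comp1_1l (two_catP C) f)))
      (vcomp (Pm a b b (id1 b) f) (hcomp (Pu b) (id2 (P1 a b f)))) =
    eq2 (comp1_1l (two_catP D) (P1 a b f));
  pf_unit_r : forall a b (f : cell1 a b),
    vcomp (P2 a b _ _ (eq2 (comp1_1r (two_catP C) f)))
      (vcomp (Pm a a b f (id1 a)) (hcomp (id2 (P1 a b f)) (Pu a))) =
    eq2 (comp1_1r (two_catP D) (P1 a b f)) }.

Record prelin_data (k : fieldType) := PrelinData {
  pobj :> Type;
  phom : pobj -> pobj -> lmodType k;
  pid : forall x, phom x x;
  pcomp : forall x y z, phom y z -> phom x y -> phom x z }.

Arguments phom {k p}.
Arguments pid {k p}.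
Arguments pcomp {k p x y z}.

Record is_prelin (k : fieldType) (C : prelin_data k) : Prop := IsPrelin {
  pcompA : forall (x y z t : C) (h : phom z t) (g : phom y z) (f : phom x y),
    pcomp h (pcomp g f) = pcomp (pcomp h g) f;
  pcomp_1l : forall (x y : C) (f : phom x y), pcomp (pid y) f = f;
  pcomp_1r : forall (x y : C) (f : phom x y), pcomp f (pid x) = f;
  pcomp_linl : forall (x y z : C) (f : phom x y),
    linear (fun g : phom y z => pcomp g f);
  pcomp_linr : forall (x y z : C) (g : phom y z),
    linear (fun f : phom x y => pcomp g f) }.

Record prelin_cat (k : fieldType) := PrelinCat {
  prelin_cat_data :> prelin_data k;
  prelin_catP : is_prelin prelin_cat_data }.

Record is_linfunctor (k : fieldType) (C D : prelin_cat k) (F : C -> D)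
    (Fm : forall x y, phom x y -> phom (F x) (F y)) : Prop := IsLinFunctor {
  lf_linear : forall x y, linear (Fm x y);
  lf_id : forall x, Fm x x (pid x) = pid (F x);
  lf_comp : forall x y z (g : phom y z) (f : phom x y),
    Fm x z (pcomp g f) = pcomp (Fm y z g) (Fm x y f) }.

Record linfunctor (k : fieldType) (C D : prelin_cat k) := LinFunctor {
  lfobj :> C -> D;
  lfmor : forall x y, phom x y -> phom (lfobj x) (lfobj y);
  linfunctorP : is_linfunctor lfmor }.

Arguments lfmor {k C D} l {x y}.

Definition is_nattrans (k : fieldType) (C D : prelin_cat k)
    (F G : linfunctor C D) (a : forall x, phom (F x) (G x)) :=
  forall x y (f : phom x y), pcomp (a y) (lfmor F f) = pcomp (lfmor G f) (a x).

Record nattrans (k : fieldType) (C D : prelin_cat k) (F G : linfunctor C D) :=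
  NatTrans {
  nt_comp :> forall x, phom (F x) (G x);
  nattransP : is_nattrans nt_comp }.

Section TwoVect.
Variable k : fieldType.
Implicit Types C D E : prelin_cat k.

Lemma linfunctor_id_subproof C : @is_linfunctor k C C id (fun _ _ f => f).
Proof. by split. Qed.

Definition linfunctor_id C : linfunctor C C :=
  LinFunctor (linfunctor_id_subproof C).

Lemma linfunctor_comp_subproof C D E (G : linfunctor D E) (F : linfunctor C D) :
  @is_linfunctor k C E (fun x => G (F x)) (fun _ _ f => lfmor G (lfmor F f)).
Proof.
case: (linfunctorP G) (linfunctorP F) => Gl G1 GM [Fl F1 FM]; split.
- by move=> x y a u v; rewrite Fl Gl.
- by move=> x; rewrite F1 G1.
- by move=> x y z g f; rewrite FM GM.
Qed.

Definition linfunctor_comp C D E (G : linfunctor D E) (F : linfunctor C D) :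
    linfunctor C E :=
  LinFunctor (linfunctor_comp_subproof G F).

Lemma nattrans_id_subproof C D (F : linfunctor C D) :
  @is_nattrans k C D F F (fun x => pid (F x)).
Proof.
move=> x y f.
by rewrite (pcomp_1l (prelin_catP D)) (pcomp_1r (prelin_catP D)).
Qed.

Definition nattrans_id C D (F : linfunctor C D) : nattrans F F :=
  NatTrans (nattrans_id_subproof F).

Lemma nattrans_vcomp_subproof C D (F G H : linfunctor C D)
    (b : nattrans G H) (a : nattrans F G) :
  @is_nattrans k C D F H (fun x => pcomp (b x) (a x)).
Proof.
move=> x y f; rewrite -(pcompA (prelin_catP D)) (nattransP a).
by rewrite !(pcompA (prelin_catP D)) (nattransP b).
Qed.

Definition nattrans_vcomp C D (F G H : linfunctor C D)
    (b : nattrans G H) (a : nattrans F G) : nattrans F H :=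
  NatTrans (nattrans_vcomp_subproof b a).

Lemma nattrans_hcomp_subproof C D E (G G' : linfunctor D E)
    (F F' : linfunctor C D) (b : nattrans G G') (a : nattrans F F') :
  @is_nattrans k C E (linfunctor_comp G F) (linfunctor_comp G' F')
    (fun x => pcomp (b (F' x)) (lfmor G (a x))).
Proof.
move=> x y f /=; rewrite -(pcompA (prelin_catP E)).
rewrite -(lf_comp (linfunctorP G)) (nattransP a) (lf_comp (linfunctorP G)).
by rewrite !(pcompA (prelin_catP E)) (nattransP b).
Qed.

Definition nattrans_hcomp C D E (G G' : linfunctor D E)
    (F F' : linfunctor C D) (b : nattrans G G') (a : nattrans F F') :
    nattrans (linfunctor_comp G F) (linfunctor_comp G' F') :=
  NatTrans (nattrans_hcomp_subproof b a).

Definition twoVect_data : two_data := {|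
  cell0 := prelin_cat k;
  cell1 := @linfunctor k;
  cell2 := @nattrans k;
  id1 := linfunctor_id;
  comp1 := linfunctor_comp;
  id2 := nattrans_id;
  vcomp := nattrans_vcomp;
  hcomp := nattrans_hcomp |}.

Lemma nattrans_eq C D (F G : linfunctor C D) (a b : nattrans F G) :
  (forall x, a x = b x) -> a = b.
Proof.
case: a b => a pa [b pb] /= ab.
have {}ab : a = b by apply: functional_extensionality_dep.
by subst b; congr NatTrans; exact: Prop_irrelevance.
Qed.

Lemma linfunctor_eq C D (F : C -> D)
    (Fm : forall x y, phom x y -> phom (F x) (F y))
    (p q : is_linfunctor Fm) : LinFunctor p = LinFunctor q.
Proof. by congr LinFunctor; exact: Prop_irrelevance. Qed.

Lemma eq2_twoVectE C D (F : C -> D)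
    (Fm : forall x y, phom x y -> phom (F x) (F y))
    (p q : is_linfunctor Fm)
    (e : (LinFunctor p : @cell1 twoVect_data C D) = LinFunctor q) (x : C) :
  (eq2 e : nattrans _ _) x = pid (F x).
Proof.
have epq : p = q by exact: Prop_irrelevance.
by subst q; rewrite (Prop_irrelevance e erefl).
Qed.

Lemma twoVectP : is_two_cat twoVect_data.
Proof.
have A (C D E K : twoVect_data) (h : cell1 E K) (g : cell1 D E)
  (f : cell1 C D) : comp1 h (comp1 g f) = comp1 (comp1 h g) f.
  exact: linfunctor_eq.
have I1 (C D : twoVect_data) (f : cell1 C D) : comp1 (id1 D) f = f.
  by case: f => F Fm p; exact: linfunctor_eq.
have I2 (C D : twoVect_data) (f : cell1 C D) : comp1 f (id1 C) = f.
  by case: f => F Fm p; exact: linfunctor_eq.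
apply: (@IsTwoCat _ A I1 I2).
- move=> C D F G H I z y x; apply: nattrans_eq => t /=.
  exact: (pcompA (prelin_catP D)).
- by move=> C D F G x; apply: nattrans_eq => t; exact: (pcomp_1l (prelin_catP D)).
- by move=> C D F G x; apply: nattrans_eq => t; exact: (pcomp_1r (prelin_catP D)).
- move=> C D E G F; apply: nattrans_eq => t /=.
  by rewrite (lf_id (linfunctorP G)) (pcomp_1l (prelin_catP E)).
- move=> C D E G G' G'' F F' F'' b' b a' a; apply: nattrans_eq => t /=.
  rewrite (lf_comp (linfunctorP G)) !(pcompA (prelin_catP E)).
  by congr pcomp; rewrite -!(pcompA (prelin_catP E)) (nattransP b).
- move=> C D E K H H' G G' F F' c b a; apply: nattrans_eq => t /=.
  rewrite !eq2_twoVectE (pcomp_1l (prelin_catP K)) (pcomp_1r (prelin_catP K)).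
  by rewrite (lf_comp (linfunctorP H)) (pcompA (prelin_catP K)).
- move=> C D [F Fm p] [F' Fm' p'] a; apply: nattrans_eq => t /=.
  rewrite !eq2_twoVectE !(pcomp_1l (prelin_catP D)).
  by rewrite (pcomp_1r (prelin_catP D)).
- move=> C D [F Fm p] [F' Fm' p'] a; apply: nattrans_eq => t /=.
  rewrite !eq2_twoVectE !(pcomp_1l (prelin_catP D)) (lf_id p).
  by rewrite !(pcomp_1r (prelin_catP D)).
Qed.

Definition twoVect : two_cat := TwoCat twoVectP.

(* eq2 in twoVect, i.e. the identity of F seen as a transformation F => G. *)
Definition idtrans C D (F G : linfunctor C D) (e : F = G) : nattrans F G :=
  @eq2 twoVect C D F G e.

(* The full subcategory on the objects of the form i t. *)
Lemma full_subcat_subproof (C : prelin_cat k) (T : Type) (i : T -> C) :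
  is_prelin {| pobj := T; phom := fun s t => phom (i s) (i t);
               pid := fun t => pid (i t);
               pcomp := fun _ _ _ g f => pcomp g f |}.
Proof.
split=> /=.
- by move=> *; exact: (pcompA (prelin_catP C)).
- by move=> *; exact: (pcomp_1l (prelin_catP C)).
- by move=> *; exact: (pcomp_1r (prelin_catP C)).
- by move=> *; exact: (pcomp_linl (prelin_catP C)).
- by move=> *; exact: (pcomp_linr (prelin_catP C)).
Qed.

Definition full_subcat (C : prelin_cat k) (T : Type) (i : T -> C) :
    prelin_cat k :=
  PrelinCat (full_subcat_subproof i).

End TwoVect.

Arguments full_subcat {k} C {T} i.

Section LieTwoGroup.
Variables (R : realType) (dG dH : nat).
Variables (G : lieGroupType R dG) (H : lieGroupType R dH).
Variable X : crossed_module G H.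

Lemma bd1 : bd X 1%g = 1%g.
Proof. by apply: (mulgI (bd X 1%g)); rewrite -bdM !mulg1. Qed.

Lemma xactg1 g : xact X g 1%g = 1%g.
Proof. by apply: (mulgI (xact X g 1%g)); rewrite -xactM !mulg1. Qed.

Lemma bdV h : bd X h^-1%g = (bd X h)^-1%g.
Proof. by apply: (mulgI (bd X h)); rewrite -bdM !mulgV bd1. Qed.

(* Arrows x -> y of the groupoid of the crossed module: the elements h of H
   with bd h * x = y, standing for the pair (x, h). *)
Definition arrow (x y : G) := {h : H | (bd X h * x)%g = y}.

Definition arrow_of (x : G) (h : H) : arrow x (bd X h * x)%g := exist _ h erefl.

Lemma arrow_id_subproof x : (bd X 1 * x)%g = x.
Proof. by rewrite bd1 mul1g. Qed.

Definition arrow_id x : arrow x x := exist _ 1%g (arrow_id_subproof x).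

Lemma arrow_vcomp_subproof x y z (b : arrow y z) (a : arrow x y) :
  (bd X (sval b * sval a) * x)%g = z.
Proof. by rewrite bdM -mulgA (svalP a) (svalP b). Qed.

Definition arrow_vcomp x y z (b : arrow y z) (a : arrow x y) : arrow x z :=
  exist _ (sval b * sval a)%g (arrow_vcomp_subproof b a).

Lemma arrow_hcomp_subproof x y x' y' (a : arrow x y) (a' : arrow x' y') :
  (bd X (sval a * xact X x^-1 (sval a')) * (x * x'))%g = (y * y')%g.
Proof.
case: a a' => [h xy] [h' xy'] /=; rewrite -xy -xy'.
by rewrite bdM bd_xact invgK -!mulgA mulKg.
Qed.

Definition arrow_hcomp x y x' y' (a : arrow x y) (a' : arrow x' y') :
    arrow (x * x')%g (y * y')%g :=
  exist _ (sval a * xact X x^-1 (sval a'))%g (arrow_hcomp_subproof a a').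

(* The strict 2-category with one object whose hom-category is the Lie
   2-group of the crossed module; comp1 g g' and hcomp follow the order of the
   product in G. *)
Definition BG_data : two_data := {|
  cell0 := unit;
  cell1 := fun _ _ => G;
  cell2 := fun _ _ => arrow;
  id1 := fun _ => 1%g;
  comp1 := fun _ _ _ g g' => (g * g')%g;
  id2 := fun _ _ => arrow_id;
  vcomp := fun _ _ _ _ _ => @arrow_vcomp _ _ _;
  hcomp := fun _ _ _ _ _ _ _ => @arrow_hcomp _ _ _ _ |}.

Lemma arrow_eq x y (a b : arrow x y) : sval a = sval b -> a = b.
Proof. by case: a b => a pa [b pb] /= ab; exact: eq_exist. Qed.

Lemma sval_eq2_BG (x y : G) (e : x = y) :
  sval (eq2 (e : (x : @cell1 BG_data tt tt) = y) : arrow x y) = 1%g.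
Proof. by subst y. Qed.

Lemma BG_subproof : is_two_cat BG_data.
Proof.
have A (a b c d : BG_data) (h : cell1 c d) (g : cell1 b c)
  (f : cell1 a b) : comp1 h (comp1 g f) = comp1 (comp1 h g) f.
  exact: mulgA.
have I1 (a b : BG_data) (f : cell1 a b) : comp1 (id1 b) f = f.
  exact: mul1g.
have I2 (a b : BG_data) (f : cell1 a b) : comp1 f (id1 a) = f.
  exact: mulg1.
apply: (@IsTwoCat _ A I1 I2).
- by move=> [] [] f g h i z y x; apply: arrow_eq; rewrite /= mulgA.
- by move=> [] [] f g x; apply: arrow_eq; rewrite /= mul1g.
- by move=> [] [] f g x; apply: arrow_eq; rewrite /= mulg1.
- by move=> [] [] [] g f; apply: arrow_eq; rewrite /= xactg1 mulg1.
- move=> [] [] [] g g' g'' f f' f'' y' y x' x; apply: arrow_eq => /=.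
  have -> : (g'^-1 = g^-1 * bd X (sval y)^-1)%g.
    by rewrite bdV -invgM (svalP y).
  rewrite xact_mul peiffer invgK xactM.
  by rewrite -!mulgA mulKg.
- move=> [] [] [] [] h h' g g' f f' z y x; apply: arrow_eq => /=.
  by rewrite !sval_eq2_BG mul1g mulg1 invgM xact_mul xactM mulgA.
- move=> [] [] f f' x; apply: arrow_eq => /=.
  by rewrite !sval_eq2_BG !mul1g mulg1 invg1 xact1.
- move=> [] [] f f' x; apply: arrow_eq => /=.
  by rewrite !sval_eq2_BG !mul1g !mulg1 xactg1 mulg1.
Qed.

Definition BG : two_cat := TwoCat BG_subproof.

End LieTwoGroup.

Section ScalarFunctions.
Variables (R : realType) (k : fieldExtType R).

(* Smoothness of the real coordinates of f, in all charts at p. *)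
Definition ksmooth_at (M : topologicalType) d (A : set (chart R M d))
    (f : M -> k) (p : M) :=
  forall c i, A c -> cdom c p ->
    smooth_at (fun u => coord (vbasis {:k}) i (f (cinv c u))) (cfun c p).

Variables (d : nat) (M : manifoldType R d).
Implicit Types (f g : M -> k) (p : M).

Lemma ksmooth_near_eq f g p :
  (\near p, f p = g p) -> ksmooth_at (atlas M) f p -> ksmooth_at (atlas M) g p.
Proof.
move=> fg fs c i cA cp n; apply: Cn_near_eq (fs c i cA cp n).
have [_ _ cK _ ci] := atlas_chart c cA.
have cip : cinv c (cfun c p) = p by apply: cK; rewrite inE.
have /ci H : cfun c p \in cfun c @` cdom c by rewrite inE; exists p.
rewrite /prop_for /continuous_at cip in H.
have {}H : \forall u \near cfun c p, f (cinv c u) = g (cinv c u) by exact: H _ fg.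
by near=> u; rewrite (near H u).
Unshelve. all: by end_near. Qed.

Lemma ksmooth_cst (a : k) p : ksmooth_at (atlas M) (fun=> a) p.
Proof. by move=> c i _ _ n; exact: Cn_cst. Qed.

Lemma ksmoothD f g p : ksmooth_at (atlas M) f p -> ksmooth_at (atlas M) g p ->
  ksmooth_at (atlas M) (fun x => f x + g x) p.
Proof.
move=> fs gs c i cA cp n.
have := CnD (fs c i cA cp n) (gs c i cA cp n).
apply: Cn_near_eq; near=> u; by rewrite /= linearD.
Unshelve. all: by end_near. Qed.

Lemma ksmooth_sum (I : Type) (r : seq I) (F : I -> M -> k) p :
  (forall i, ksmooth_at (atlas M) (F i) p) ->
  ksmooth_at (atlas M) (fun x => \sum_(i <- r) F i x) p.
Proof.
move=> Fs; elim: r => [|i r IH].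
  rewrite (_ : (fun x => _) = fun=> 0); first exact: ksmooth_cst.
  by apply/funext => x; rewrite big_nil.
rewrite (_ : (fun x => _) = fun x => F i x + \sum_(j <- r) F j x).
  exact: ksmoothD.
by apply/funext => x; rewrite big_cons.
Qed.

Lemma Cn_sum (I : Type) (r : seq I) (F : I -> 'rV[R]_d -> R) n x :
  (forall i, Cn n (F i) x) -> Cn n (fun x => \sum_(i <- r) F i x) x.
Proof.
move=> Fs; elim: r => [|i r IH].
  rewrite (_ : (fun x => _) = fun=> 0); first exact: Cn_cst.
  by apply/funext => u; rewrite big_nil.
rewrite (_ : (fun x => _) = fun x => F i x + \sum_(j <- r) F j x).
  exact: CnD.
by apply/funext => u; rewrite big_cons.
Qed.

Lemma ksmoothM f g p : ksmooth_at (atlas M) f p -> ksmooth_at (atlas M) g p ->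
  ksmooth_at (atlas M) (fun x => f x * g x) p.
Proof.
move=> fs gs c l cA cp n.
pose b := vbasis {:k}.
have E (x y : k) : coord b l (x * y) = \sum_i \sum_j
    (coord b i x * coord b j y) * coord b l (b`_i * b`_j).
  rewrite {1}(coord_vbasis (memvf x)) {1}(coord_vbasis (memvf y)).
  rewrite mulr_suml linear_sum; apply: eq_bigr => i _.
  rewrite mulr_sumr linear_sum; apply: eq_bigr => j _.
  by rewrite -scalerAl -scalerAr !linearZ /= mulrA.
rewrite (_ : (fun u => _) = fun u => \sum_i \sum_j
    (coord b i (f (cinv c u)) * coord b j (g (cinv c u))) * coord b l (b`_i * b`_j)).
  apply: Cn_sum => i; apply: Cn_sum => j.
  apply: CnM (Cn_cst _ _ _); apply: CnM; [exact: fs|exact: gs].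
by apply/funext => u; rewrite E.
Qed.

End ScalarFunctions.

Section Rep.
Variables (R : realType) (k : fieldExtType R) (dG dH : nat).
Variables (G : lieGroupType R dG) (H : lieGroupType R dH).
Variable X : crossed_module G H.

(* A local trivialization; only the values of lmap on ldom are meaningful. *)
Record loc_triv (V : G -> vectType k) := LocTriv {
  ldom : set G;
  lrank : nat;
  lmap : forall x, 'Hom(V x, 'rV[k]_lrank) }.

(* A family of finite-dimensional k-vector spaces over G with an atlas of local
   trivializations, the smooth structure of the total space (see is_vbundle).
   Working with families of fibres makes pullbacks strictly functorial. *)
Record bundle := Bundle {
  fib :> G -> vectType k;
  triv : set (loc_triv fib) }.

Arguments triv : clear implicits.

Definition mxcoef (V W : G -> vectType k) (s : loc_triv V) (t : loc_triv W)
    (x y : G) (A : 'Hom(V x, W y)) (i : 'I_(lrank s)) (j : 'I_(lrank t)) : k :=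
  lmap t y (A ((lmap s x)^-1%VF 'e_i)) 0 j.

Arguments mxcoef {V W} s t {x y}.

(* Smoothness of a fibrewise linear map over the identity of G. *)
Definition smooth_bmap (V W : bundle) (f : forall x, 'Hom(V x, W x)) :=
  forall s t p i j, triv V s -> triv W t -> ldom s p -> ldom t p ->
    ksmooth_at (atlas G) (fun x => mxcoef s t (f x) i j) p.

Record is_vbundle (V : bundle) : Prop := IsVBundle {
  triv_open : forall s, triv V s -> open (ldom s);
  triv_cover : forall p, exists2 s, triv V s & ldom s p;
  triv_bij : forall s x, triv V s -> ldom s x -> bijective (lmap s x);
  triv_smooth : smooth_bmap (fun x => \1%VF : 'Hom(V x, V x)) }.

Record rep_data := RepData {
  rbun :> bundle;
  ract : forall x y, arrow X x y -> 'Hom(rbun x, rbun y) }.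

(* A Lie groupoid morphism, identity on objects, to the groupoid of linear
   isomorphisms between fibres: (x, h) |-> rho (x, h) is required to be smooth
   on the manifold G * H of arrows, in local trivializations at the source x and
   at the target bd h * x. *)
Record is_rep (V : rep_data) : Prop := IsRep {
  rep_vbundle : is_vbundle V;
  ract_bij : forall x y (a : arrow X x y), bijective (ract V a);
  ract_id : forall x, ract V (arrow_id X x) = \1%VF;
  ract_comp : forall x y z (b : arrow X y z) (a : arrow X x y),
    ract V (arrow_vcomp b a) = (ract V b \o ract V a)%VF;
  ract_smooth : forall s t (p : G * H) i j,
    triv V s -> triv V t -> ldom s p.1 -> ldom t (bd X p.2 * p.1)%g ->
    ksmooth_at (prod_atlas (atlas G) (atlas H))
      (fun q => mxcoef s t (ract V (arrow_of X q.1 q.2)) i j) p }.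

Definition rep := {V : rep_data | is_rep V}.

Definition mk_rep (V : rep_data) (p : is_rep V) : rep := exist _ V p.

Definition is_rmor (V W : rep_data) (f : forall x, 'Hom(V x, W x)) :=
  smooth_bmap f /\
  forall x y (a : arrow X x y), (f y \o ract V a = ract W a \o f x)%VF.

Record rmor (V W : rep_data) := RMor {
  rmap :> forall x, 'Hom(V x, W x);
  rmorP : is_rmor rmap }.

Lemma rmor_eq V W (f g : rmor V W) : (forall x, f x = g x) -> f = g.
Proof.
case: f g => f pf [g pg] /= fg.
have {}fg : f = g by apply: functional_extensionality_dep.
by subst g; congr RMor; exact: Prop_irrelevance.
Qed.

Section RMorModule.
Variables V W : rep_data.

Lemma mxcoef_lin (s : loc_triv V) (t : loc_triv W) x y (a : k)
    (A B : 'Hom(V x, W y)) i j :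
  mxcoef s t (a *: A + B) i j = a * mxcoef s t A i j + mxcoef s t B i j.
Proof. by rewrite /mxcoef !lfunE /= !lfunE /= linearP /= !mxE. Qed.

Lemma rmor_lin_subproof (a : k) (f g : rmor V W) :
  is_rmor (fun x => a *: f x + g x).
Proof.
split=> [s t p i j sV tW sp tp|x y b].
  rewrite (_ : (fun x => _) =
      fun x => a * mxcoef s t (f x) i j + mxcoef s t (g x) i j); last first.
    by apply/funext => x; rewrite mxcoef_lin.
  apply: ksmoothD; last exact: (rmorP g).1.
  by apply: ksmoothM; [exact: ksmooth_cst|exact: (rmorP f).1].
rewrite comp_lfunDl comp_lfunDr -comp_lfunZl -comp_lfunZr.
by rewrite (rmorP f).2 (rmorP g).2.
Qed.

Lemma rmor0_subproof : is_rmor (fun x => 0 : 'Hom(V x, W x)).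
Proof.
split=> [s t p i j sV tW sp tp|x y b]; last by rewrite comp_lfun0l comp_lfun0r.
rewrite (_ : (fun x => _) = fun=> 0); first exact: ksmooth_cst.
by apply/funext => x; rewrite /mxcoef lfunE /= linear0 mxE.
Qed.

Definition rmor0 := RMor rmor0_subproof.
Definition rmor_lin a f g := RMor (rmor_lin_subproof a f g).

HB.instance Definition _ := gen_eqMixin (rmor V W).
HB.instance Definition _ := gen_choiceMixin (rmor V W).

Fact rmor_addA : associative (rmor_lin 1).
Proof. by move=> f g h; apply: rmor_eq => x /=; rewrite !scale1r addrA. Qed.

Fact rmor_addC : commutative (rmor_lin 1).
Proof. by move=> f g; apply: rmor_eq => x /=; rewrite !scale1r addrC. Qed.

Fact rmor_add0 : left_id rmor0 (rmor_lin 1).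
Proof. by move=> f; apply: rmor_eq => x /=; rewrite scaler0 add0r. Qed.

Fact rmor_addN : left_inverse rmor0 (fun f => rmor_lin (-1) f rmor0) (rmor_lin 1).
Proof.
move=> f; apply: rmor_eq => x /=.
by rewrite scale1r addr0 scaleN1r addNr.
Qed.

HB.instance Definition _ :=
  GRing.isZmodule.Build (rmor V W) rmor_addA rmor_addC rmor_add0 rmor_addN.

Lemma rmorDE (f g : rmor V W) x : (f + g) x = f x + g x.
Proof. by rewrite /= scale1r. Qed.

Let rmor_scale a (f : rmor V W) : rmor V W := rmor_lin a f rmor0.

Fact rmor_scaleA a b f : rmor_scale a (rmor_scale b f) = rmor_scale (a * b) f.
Proof. by apply: rmor_eq => x; rewrite /= !addr0 scalerA. Qed.

Fact rmor_scale1 : left_id 1 rmor_scale.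
Proof. by move=> f; apply: rmor_eq => x; rewrite /= addr0 scale1r. Qed.

Fact rmor_scaleDr : right_distributive rmor_scale +%R.
Proof.
move=> a f g; apply: rmor_eq => x.
by rewrite /= !scale1r !addr0 scalerDr.
Qed.

Fact rmor_scaleDl f : {morph rmor_scale^~ f : a b / a + b}.
Proof.
move=> a b; apply: rmor_eq => x.
by rewrite /= scale1r !addr0 scalerDl.
Qed.

HB.instance Definition _ := GRing.Zmodule_isLmodule.Build k (rmor V W)
  rmor_scaleA rmor_scale1 rmor_scaleDr rmor_scaleDl.

Lemma rmorZE a (f : rmor V W) x : (a *: f) x = a *: f x.
Proof. by rewrite /= addr0. Qed.

End RMorModule.

Lemma rmor_id_subproof (V : rep) :
  @is_rmor (sval V) (sval V) (fun x => \1%VF).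
Proof.
split; first exact: triv_smooth (rep_vbundle (svalP V)).
by move=> x y a; rewrite comp_lfun1l comp_lfun1r.
Qed.

Lemma mxcoef_comp (U V W : G -> vectType k) (r : loc_triv U) (s : loc_triv V)
    (t : loc_triv W) x y z (B : 'Hom(V y, W z)) (A : 'Hom(U x, V y)) i l :
  bijective (lmap s y) ->
  mxcoef r t (B \o A)%VF i l =
  \sum_j mxcoef r s A i j * mxcoef s t B j l.
Proof.
move=> sbij; rewrite /mxcoef comp_lfunE.
set v := A _.
have sK : cancel (lmap s y) (lmap s y)^-1%VF.
  by apply: lker0_lfunK; apply/lker0P; exact: bij_inj.
rewrite -{1}(sK v) [in LHS](row_sum_delta (lmap s y v)).
rewrite !linear_sum /= summxE; apply: eq_bigr => j _.
by rewrite !linearZ /= mxE.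
Qed.

Lemma rmor_comp_subproof (U V W : rep)
    (g : rmor (sval V) (sval W)) (f : rmor (sval U) (sval V)) :
  is_rmor (fun x => (g x \o f x)%VF).
Proof.
split=> [r t p i l rU tW rp tp|x y a]; last first.
  by rewrite -comp_lfunA (rmorP f).2 comp_lfunA (rmorP g).2 -comp_lfunA.
have VV := rep_vbundle (svalP V).
have [s sV sp] := triv_cover VV p.
apply: (@ksmooth_near_eq _ _ _ _
  (fun x => \sum_j mxcoef r s (f x) i j * mxcoef s t (g x) j l)).
  have : nbhs p (ldom s) by apply: open_nbhs_nbhs; split=> //; exact: triv_open sV.
  by apply: filterS => x sx; rewrite (mxcoef_comp _ _ _ _ (triv_bij VV sV sx)).
apply: ksmooth_sum => j; apply: ksmoothM.
  exact: (rmorP f).1.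
exact: (rmorP g).1.
Qed.

Definition Rep_data : prelin_data k := {|
  pobj := rep;
  phom := fun V W => rmor (sval V) (sval W);
  pid := fun V => RMor (rmor_id_subproof V);
  pcomp := fun _ _ _ g f => RMor (rmor_comp_subproof g f) |}.

Lemma Rep_subproof : is_prelin Rep_data.
Proof.
split=> /=.
- by move=> U V W Z h g f; apply: rmor_eq => x /=; rewrite comp_lfunA.
- by move=> U V f; apply: rmor_eq => x /=; rewrite comp_lfun1l.
- by move=> U V f; apply: rmor_eq => x /=; rewrite comp_lfun1r.
- move=> U V W f a g g'; apply: rmor_eq => x.
  by rewrite /= !scale1r !addr0 comp_lfunDl -comp_lfunZl.
- move=> U V W g a f f'; apply: rmor_eq => x.
  by rewrite /= !scale1r !addr0 comp_lfunDr -comp_lfunZr.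
Qed.

Definition Rep : prelin_cat k := PrelinCat Rep_subproof.
End Rep.

Arguments triv {R k dG G} b.
Arguments mxcoef {R k dG G V W} s t {x y}.
Arguments ract {R k dG dH G H X} V {x y} : rename.

Section TrivialRep.
Import passmx.
Variables (R : realType) (k : fieldExtType R) (dG dH : nat).
Variables (G : lieGroupType R dG) (H : lieGroupType R dH).
Variable X : crossed_module G H.

(* The product bundle V * G, with its constant global trivializations. *)
Definition triv_bundle (V : vectType k) : bundle k G := {|
  fib := fun _ => V;
  triv := [set s | exists r (L : 'Hom(V, 'rV[k]_r)), bijective L /\
                   s = {| ldom := setT; lrank := r; lmap := fun _ => L |}] |}.

Lemma triv_bundleP (V : vectType k) : is_vbundle (triv_bundle V).
Proof.
split=> /=.
- by move=> _ [r [L [_ ->]]]; exact: openT.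
- move=> p; have bV := vbasisP {:V}.
  pose L : 'Hom(V, 'rV[k]_(\dim {:V})) := linfun (rVof (vbasis {:V})).
  exists {| ldom := setT; lrank := _; lmap := fun _ => L |} => //.
  exists _, L; split=> //; exists (vecof (vbasis {:V})) => u; rewrite /L lfunE /=.
    exact: (rVofK bV).
  exact: (vecofK bV).
- by move=> _ x [r [L [Lb ->]]] _.
- move=> s t p i j [r [L [_ es]]] [r' [L' [_ et]]] _ _; subst s t.
  by rewrite /mxcoef /=; exact: ksmooth_cst.
Qed.

Record trep_data := TRepData {
  tfib : vectType k;
  tact : forall x y, arrow X x y -> 'Hom(tfib, tfib) }.

Definition rep_of_trep (T : trep_data) : rep_data k X :=
  {| rbun := triv_bundle (tfib T); ract := tact T |}.

Definition trep := {T : trep_data | is_rep (rep_of_trep T)}.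

Definition mk_trep (T : trep_data) (p : is_rep (rep_of_trep T)) : trep :=
  exist _ T p.

Definition Rep_tr : prelin_cat k :=
  full_subcat (Rep k X) (fun T : trep => mk_rep (svalP T)).

End TrivialRep.

Section Translation.
Variables (R : realType) (k : fieldExtType R) (dG dH : nat).
Variables (G : lieGroupType R dG) (H : lieGroupType R dH).
Variable X : crossed_module G H.
Implicit Types g x y : G.

Lemma trans_arrow_subproof g x y (a : arrow X x y) :
  (bd X (sval a) * (x * g))%g = (y * g)%g.
Proof. by rewrite mulgA (svalP a). Qed.

(* From (x, h) : x -> y to (x g, h) : x g -> y g. *)
Definition trans_arrow g x y (a : arrow X x y) : arrow X (x * g)%g (y * g)%g :=
  exist _ (sval a) (trans_arrow_subproof g a).

Lemma whisk_arrow_subproof x g g' (a : arrow X g g') :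
  (bd X (xact X x^-1 (sval a)) * (x * g))%g = (x * g')%g.
Proof.
by case: a => h gg' /=; rewrite -gg' bd_xact invgK -!mulgA mulKg.
Qed.

(* From (g, h) : g -> g' to (x g, alpha(x)^-1 (h)) : x g -> x g', where
   g' = bd h * g. *)
Definition whisk_arrow x g g' (a : arrow X g g') :
    arrow X (x * g)%g (x * g')%g :=
  exist _ (xact X x^-1%g (sval a)) (whisk_arrow_subproof x a).

Definition trans_triv g (V : G -> vectType k) (s : loc_triv V) :
    loc_triv (fun x => V (x * g)%g) :=
  {| ldom := [set x | ldom s (x * g)%g];
     lrank := lrank s;
     lmap := fun x => lmap s (x * g)%g |}.

Arguments trans_triv g {V} s.

(* The pullback of V along right translation by g. *)
Definition trans_bundle g (V : bundle k G) : bundle k G :=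
  {| fib := fun x => V (x * g)%g; triv := trans_triv g @` triv V |}.

Definition trans_rep g (V : rep_data k X) : rep_data k X :=
  {| rbun := trans_bundle g V;
     ract := fun x y a => ract V (trans_arrow g a) |}.

Definition trans_trep g (T : trep_data k X) : trep_data k X :=
  {| tfib := tfib T; tact := fun x y a => tact T (trans_arrow g a) |}.

End Translation.

Arguments trans_triv {R k dG G} g {V} s.

(* Main.v *)
Require Import Defs.
From HB Require Import structures.
From mathcomp Require Import all_boot all_order all_algebra all_field.
From mathcomp Require Import all_classical all_reals all_analysis.

(** Right translation by [g] pulls a representation of the Lie groupoid of the
crossed module back along [x |-> x g, (x, h) |-> (x g, h)], and an arrow [(g, h)]
acts on the pullbacks through [rho] evaluated at the whiskered arrow
[(x g, alpha(x)^-1 h)]. The proof has three independent ingredients.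

Smoothness. Every function that must be shown smooth is a matrix coefficient
of the given data composed with one of the maps [x |-> x g],
[(x, h) |-> (x g, h)] or [x |-> (x g, alpha(x)^-1 h)]. These are smooth because
multiplication, inversion and the action are, and because smooth maps compose;
the last point rests on the chain rule for iterated partial derivatives
([Cn_comp], [ksmooth_comp]).

Algebra. Each identity between components of 2-cells equates two composites of
operators [rho a]. As [rho] is functorial and an arrow is determined by its
source, target and label in [H], it reduces to an identity between labels in
[H]. Equivariance of the transformation of [(g, h)] is the Peiffer identity
([whisk_is_rmor]), its compatibility with vertical composition is
multiplicativity of the action ([whisk_vcomp]), and that with horizontal
composition is the action law ([whisk_hcomp]).

Strictness. The functors [F_g F_g'] and [F_(g g')] agree only up to
associativity in [G], so the fibres [V ((x g) g')] and [V (x (g g'))] are equal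
without being the same expression. Since [phi =1 psi] implies [phi = psi], two
pullbacks along pointwise equal maps are equal ([pulled_rep_eq]); this gives
the strict equalities of functors. The identity 2-cells that they induce are
transports of fibres, and [castv_ract] turns such a transport into [rho] of an
arrow with label [1], so that the algebra above covers them too. Finally the
associativity and unit axioms of a pseudofunctor hold for free when the
structure 2-cells are identities of equal 1-cells, for all cells in those
axioms are then of that kind ([strict_pseudofunctor]).

On trivial bundles, translation maps the constant trivializations onto
themselves ([trans_triv_const]), so pulling back a representation there is the
general pullback, and smoothness is inherited from the general case. *)

Set Implicit Arguments.
Unset Strict Implicit.
Unset Printing Implicit Defensive.

Import Order.TTheory GRing.Theory Num.Theory numFieldNormedType.Exports.

Local Open Scope classical_set_scope.
Local Open Scope ring_scope.

(** * Chain rule for functions of class C^n *)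

Section ChainRule.
Variable R : realType.

Lemma continuous_coord (T : topologicalType) n (f : T -> 'rV[R]_n) x :
  (forall j, {for x, continuous (fun u => f u 0 j)}) -> {for x, continuous f}.
Proof.
move=> cf; rewrite (_ : f = fun u => \sum_j f u 0 j *: 'e_j); last first.
  by apply/funext => u; rewrite -row_sum_delta.
by apply: cvg_big => [|j _]; [exact: add_continuous|apply: cvgZr_tmp; exact: cf].
Qed.

Lemma differentiable_rV (V : normedModType R) n (f : V -> 'rV[R]_n) x :
  (forall j, differentiable (fun u => f u 0 j) x) -> differentiable f x.
Proof.
move=> df; rewrite (_ : f = \sum_j (fun u => f u 0 j *: 'e_j)); last first.
  by apply/funext => u; rewrite fct_sumE -row_sum_delta.
by apply: differentiable_sum => j; apply: differentiableZl.
Qed.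

Lemma derive_comp_rV m n (f : 'rV[R]_n -> R) (g : 'rV[R]_m -> 'rV[R]_n) x v :
  (forall j, differentiable (fun u => g u 0 j) x) -> differentiable f (g x) ->
  'D_v (f \o g) x = \sum_j 'D_('e_j) f (g x) * 'D_v (fun u => g u 0 j) x.
Proof.
move=> dgj df; have dg := differentiable_rV dgj.
rewrite deriveE; last exact: differentiable_comp.
rewrite diff_comp //= -(deriveE _ dg) derive_mx; last exact: diff_derivable.
rewrite [X in 'd f _ X]row_sum_delta linear_sum; apply: eq_bigr => j _.
by rewrite linearZ /= mxE -(deriveE _ df) mulrC.
Qed.

Lemma Cn_continuous d n (f : 'rV[R]_d -> R) x :
  Cn n f x -> \forall y \near x, {for y, continuous f}.
Proof. by elim: n f => [|n IH] f // /Cn_pred /IH. Qed.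

(** By induction on the order: a partial derivative of the composite is a sum of
products of [('D_('e_j) f) \o g] with partial derivatives of the coordinates of
[g]. Both factors have one order less, the first by the induction hypothesis
for the partial derivatives of [f] and the same [g]. *)
Lemma Cn_comp N m n (f : 'rV[R]_n -> R) (g : 'rV[R]_m -> 'rV[R]_n) x :
  (forall j, Cn N (fun u => g u 0 j) x) -> Cn N f (g x) -> Cn N (f \o g) x.
Proof.
elim: N f => [|N IH] f gC fC.
  have cg : \forall y \near x, {for y, continuous g}.
    have : \forall y \near x, forall j, {for y, continuous (fun u => g u 0 j)}.
      exact: (@filter_forall _ _ (fun j y =>
        {for y, continuous (fun u => g u 0 j)}) _ _ gC).
    by apply: filterS => y; exact: continuous_coord.
  have fg := (nbhs_singleton cg) _ fC.
  near=> y; apply: continuous_comp; near: y; [exact: cg|exact: fg].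
have cg : {for x, continuous g}.
  by apply: continuous_coord => j; exact: (nbhs_singleton (Cn_continuous (gC j))).
have dg : \forall y \near x, forall j, differentiable (fun u => g u 0 j) y.
  exact: (@filter_forall _ _ (fun j y =>
    differentiable (fun u => g u 0 j) y) _ _
    (fun j => (gC j).1)).
have df : \forall y \near x, differentiable f (g y) by exact: (cg _ fC.1).
split=> [|i].
  near=> y; apply: differentiable_comp; last by near: y.
  by apply: differentiable_rV; near: y.
apply: (@Cn_near_eq _ _ _ (fun y =>
    \sum_j ('D_('e_j) f \o g) y * 'D_('e_i) (fun u => g u 0 j) y)).
  by near=> y; rewrite derive_comp_rV //; near: y.
apply: Cn_sum => j; apply: CnM; last exact: (gC j).2.
by apply: IH => [l|]; [exact: Cn_pred|exact: fC.2].
Unshelve. all: by end_near. Qed.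

Lemma Cn_coord d N (j : 'I_d) x : Cn N (fun u : 'rV[R]_d => u 0 j) x.
Proof.
case: N => [|N].
  by near=> y; exact: coord_continuous.
split=> [|i]; first by near=> y; exact: differentiable_coord.
rewrite (_ : (fun y => _) = cst (('e_i : 'rV[R]_d) 0 j)); first exact: Cn_cst.
apply/funext => y /=; have /derive_mx : derivable id y ('e_i : 'rV[R]_d).
  exact: derivable_id.
by rewrite derive_id => /matrixP /(_ 0 j); rewrite !mxE.
Unshelve. all: by end_near. Qed.

End ChainRule.

(** * Smooth maps between spaces with charts *)

Section SmoothMaps.
Variable R : realType.

(** The part of being a manifold that composing smooth maps requires. Product
atlases satisfy it, so it covers the manifold of arrows [G * H], which is given
only through its product atlas. *)
Definition charted (M : topologicalType) d (A : set (chart R M d)) :=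
  (forall c, A c -> [/\ open (cdom c), {in cdom c, cancel (cfun c) (cinv c)} &
     {in cfun c @` cdom c, continuous (cinv c)}]) /\
  (forall p, exists2 c, A c & cdom c p).

Definition smooth_fun (M : topologicalType) d (A : set (chart R M d))
    (f : M -> R) (p : M) :=
  forall c, A c -> cdom c p -> smooth_at (f \o cinv c) (cfun c p).

(** Near a point, [f \o g] read in a chart [c] of [M] is [f] read in a chart [c']
of [N] after [g] read in [c] and [c'], because [cinv c' \o cfun c'] is the
identity on an open set and [g] is continuous; the chain rule then applies. *)
Lemma smooth_fun_comp (M N : topologicalType) m n (A : set (chart R M m))
    (B : set (chart R N n)) (f : N -> R) (g : M -> N) p :
  charted A -> charted B -> smooth_map A B g -> smooth_fun B f (g p) ->
  smooth_fun A (f \o g) p.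
Proof.
move=> [Ac _] [Bc Bcov] [gc gs] fs c cA cp N0.
have [c' cB cgp] := Bcov (g p).
have [_ cK ci] := Ac _ cA; have [oc' cK' _] := Bc _ cB.
have cip : cinv c (cfun c p) = p by apply: cK; rewrite inE.
have gci : {for cfun c p, continuous (g \o cinv c)}.
  apply: continuous_comp; last exact: gc.
  by apply: ci; rewrite inE; exists p.
apply: (@Cn_near_eq _ _ _ ((f \o cinv c') \o (cfun c' \o g \o cinv c))).
  have : \forall u \near cfun c p, cdom c' (g (cinv c u)).
    by apply: gci; rewrite /= cip; apply: open_nbhs_nbhs.
  by apply: filterS => u uc /=; rewrite cK' // inE.
apply: Cn_comp => [j|]; first exact: (gs c c' p j cA cB cp cgp).
by rewrite /= cip; exact: fs.
Qed.

Lemma smooth_map_comp (M N K : topologicalType) m n k (A : set (chart R M m))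
    (B : set (chart R N n)) (C : set (chart R K k)) (f : N -> K) (g : M -> N) :
  charted A -> charted B -> smooth_map A B g -> smooth_map B C f ->
  smooth_map A C (f \o g).
Proof.
move=> cA cB gs [fc fs]; split.
  by move=> x; apply: continuous_comp; [exact: gs.1|exact: fc].
move=> c c' p j Ac Cc' cp c'p.
apply: (@smooth_fun_comp _ _ _ _ A B (fun y => cfun c' (f y) 0 j) g) => //.
by move=> e Be ep; exact: fs.
Qed.

Lemma smooth_map_cst (M N : topologicalType) m n (A : set (chart R M m))
    (B : set (chart R N n)) (q : N) : smooth_map A B (fun=> q).
Proof. by split=> [|c c' p j _ _ _ _ N0]; [exact: cst_continuous|exact: Cn_cst]. Qed.

Lemma smooth_map_pair (M N K : topologicalType) m n k (A : set (chart R M m))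
    (B : set (chart R N n)) (C : set (chart R K k)) (f : M -> N) (g : M -> K) :
  smooth_map A B f -> smooth_map A C g ->
  smooth_map A (prod_atlas B C) (fun x => (f x, g x)).
Proof.
move=> [fc fs] [gc gs]; split.
  by move=> x; apply: cvg_pair; [exact: fc|exact: gc].
move=> c _ p j Ac [b Bb [b' Cb' <-]] cp [/= bp b'p].
rewrite /prod_chart /= -[j]splitK; case: (fintype.split j) => i /=.
  rewrite (_ : (fun u => _) = fun u => cfun b (f (cinv c u)) 0 i).
    exact: fs.
  by apply/funext => u; rewrite row_mxEl.
rewrite (_ : (fun u => _) = fun u => cfun b' (g (cinv c u)) 0 i).
  exact: gs.
by apply/funext => u; rewrite row_mxEr.
Qed.

Lemma prod_charted (M N : topologicalType) m n (A : set (chart R M m))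
    (B : set (chart R N n)) :
  charted A -> charted B -> charted (prod_atlas A B).
Proof.
move=> [Ac Acov] [Bc Bcov]; split; last first.
  move=> [p q]; have [c cA cp] := Acov p; have [c' cB cq] := Bcov q.
  by exists (prod_chart c c') => //; exists c => //; exists c'.
move=> _ [c cA [c' cB <-]].
have [K0 K1 i1] := Ac _ cA; have [L0 K2 i2] := Bc _ cB; split.
- by rewrite openE => -[p q] [/= cp cq]; exists (cdom c, cdom c') => //=;
    split; apply: open_nbhs_nbhs.
- move=> [p q]; rewrite inE => -[/= cp cq] /=.
  by rewrite row_mxKl row_mxKr K1 ?inE // K2 ?inE.
- move=> v; rewrite inE => -[[p q] [/= cp cq] <-{v}].
  have ci : {for row_mx (cfun c p) (cfun c' q), continuous (cinv c \o lsubmx)}.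
    apply: continuous_comp; first exact: continuous_lsubmx.
    by apply: i1; rewrite inE row_mxKl; exists p.
  have ci' : {for row_mx (cfun c p) (cfun c' q), continuous (cinv c' \o rsubmx)}.
    apply: continuous_comp; first exact: continuous_rsubmx.
    by apply: i2; rewrite inE row_mxKr; exists q.
  exact: (cvg_pair ci ci').
Qed.

Lemma atlas_charted d (M : manifoldType R d) : charted (atlas M).
Proof.
split=> [c /atlas_chart[]|]; [by split|exact: atlas_cover].
Qed.

(** In charts this is the projection [lsubmx] followed by a change of charts of
[M], which is smooth since the atlas of [M] is. *)
Lemma smooth_map_fst d e (M : manifoldType R d) (N : manifoldType R e) :
  smooth_map (prod_atlas (atlas M) (atlas N)) (atlas M) fst.
Proof.
split; first by move=> x; exact: cvg_fst.
move=> _ b [p q] j [c cM [c' cN <-]] bM [/= cp cq] bp N0.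
apply: (@Cn_comp _ _ _ _ (fun u => cfun b (cinv c u) 0 j) lsubmx).
  move=> l; rewrite (_ : (fun u => _) =
    fun u : 'rV[R]_(d + e) => u 0 (lshift e l)); first exact: Cn_coord.
  by apply/funext => u; rewrite mxE.
by rewrite row_mxKl; exact: (atlas_compat.2 c b p j).
Qed.

Lemma smooth_map_snd d e (M : manifoldType R d) (N : manifoldType R e) :
  smooth_map (prod_atlas (atlas M) (atlas N)) (atlas N) snd.
Proof.
split; first by move=> x; exact: cvg_snd.
move=> _ b [p q] j [c cM [c' cN <-]] bM [/= cp cq] bp N0.
apply: (@Cn_comp _ _ _ _ (fun u => cfun b (cinv c' u) 0 j) rsubmx).
  move=> l; rewrite (_ : (fun u => _) =
    fun u : 'rV[R]_(d + e) => u 0 (rshift d l)); first exact: Cn_coord.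
  by apply/funext => u; rewrite mxE.
by rewrite row_mxKr; exact: (atlas_compat.2 c' b q j).
Qed.

Lemma ksmooth_comp (k : fieldExtType R) (M N : topologicalType) m n
    (A : set (chart R M m)) (B : set (chart R N n)) (f : N -> k) (g : M -> N) p :
  charted A -> charted B -> smooth_map A B g -> ksmooth_at B f (g p) ->
  ksmooth_at A (f \o g) p.
Proof.
move=> cA cB gs fs c i Ac cp.
apply: (@smooth_fun_comp _ _ _ _ A B (fun y => coord (vbasis {:k}) i (f y)) g p
  cA cB gs _ c Ac cp).
by move=> e Be ep; exact: fs.
Qed.

End SmoothMaps.

(** * The smooth maps of the crossed module *)

Section TranslationsSmooth.
Variables (R : realType) (dG dH : nat).
Variables (G : lieGroupType R dG) (H : lieGroupType R dH).
Variable X : crossed_module G H.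

Lemma rtrans_smooth (g : G) : smooth_map (atlas G) (atlas G) (fun x => x * g)%g.
Proof.
apply: (@smooth_map_comp _ _ _ _ _ _ _ _ (prod_atlas (atlas G) (atlas G)) _
  (fun p : G * G => p.1 * p.2)%g (fun x => (x, g))).
- exact: atlas_charted.
- by apply: prod_charted; exact: atlas_charted.
- by apply: smooth_map_pair; [exact: atlas_compat|exact: smooth_map_cst].
- exact: mulg_smooth.
Qed.

Lemma rtrans_arrow_smooth (g : G) :
  smooth_map (prod_atlas (atlas G) (atlas H)) (prod_atlas (atlas G) (atlas H))
    (fun p => (p.1 * g, p.2)%g).
Proof.
apply: smooth_map_pair; last exact: smooth_map_snd.
apply: (@smooth_map_comp _ _ _ _ _ _ _ _ (atlas G) _ (fun x => x * g)%g fst).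
- by apply: prod_charted; exact: atlas_charted.
- exact: atlas_charted.
- exact: smooth_map_fst.
- exact: rtrans_smooth.
Qed.

Lemma whisk_smooth (g : G) (h : H) :
  smooth_map (atlas G) (prod_atlas (atlas G) (atlas H))
    (fun x => (x * g, xact X x^-1 h)%g).
Proof.
apply: smooth_map_pair; first exact: rtrans_smooth.
apply: (@smooth_map_comp _ _ _ _ _ _ _ _ (prod_atlas (atlas G) (atlas H)) _
  (fun p => xact X p.1 p.2) (fun x => (x^-1, h)%g)).
- exact: atlas_charted.
- by apply: prod_charted; exact: atlas_charted.
- by apply: smooth_map_pair; [exact: invg_smooth|exact: smooth_map_cst].
- exact: xact_smooth.
Qed.

End TranslationsSmooth.

(** * Strict 2-functors and equality of functors *)

Section StrictFunctors.

Lemma vcomp_eq2 (C : two_cat) (a b : C) (f g h : cell1 a b) (e' : g = h)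
    (e : f = g) : vcomp (eq2 e') (eq2 e) = eq2 (etrans e e').
Proof. by subst g h; exact: (vcomp_1l (two_catP C)). Qed.

Lemma hcomp_id2_eq2 (C : two_cat) (a b c : C) (h : cell1 b c)
    (f g : cell1 a b) (e : f = g) :
  hcomp (id2 h) (eq2 e) = eq2 (f_equal (comp1 h) e).
Proof. by subst g; exact: (hcomp_id (two_catP C)). Qed.

Lemma hcomp_eq2_id2 (C : two_cat) (a b c : C) (g h : cell1 b c)
    (f : cell1 a b) (e : g = h) :
  hcomp (eq2 e) (id2 f) = eq2 (f_equal (comp1^~ f) e).
Proof. by subst h; exact: (hcomp_id (two_catP C)). Qed.

Lemma eq2_irrelevance (C : two_data) (a b : C) (f g : cell1 a b)
    (e e' : f = g) : eq2 e = eq2 e'.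
Proof. by rewrite (Prop_irrelevance e e'). Qed.

Lemma eq2_invertible (C : two_cat) (a b : C) (f g : cell1 a b) (e : f = g) :
  invertible2 (eq2 e).
Proof.
by exists (eq2 (esym e)); subst g; split; exact: (vcomp_1l (two_catP C)).
Qed.

(** Associativity and unit coherence involve no arrow beyond the [eq2] of some
equalities of 1-cells. Whiskering, composing and mapping such 2-cells yields
2-cells of the same form, and two of them with the same ends are equal because
proofs of equality are. Naturality of the multiplication is thus the only
condition that mentions [eq2]. *)
Lemma strict_pseudofunctor (C D : two_cat) (P0 : C -> D)
    (P1 : forall a b, cell1 a b -> cell1 (P0 a) (P0 b))
    (P2 : forall a b (f g : cell1 a b), cell2 f g -> cell2 (P1 a b f) (P1 a b g))
    (multE : forall a b c (g : cell1 b c) (f : cell1 a b),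
       comp1 (P1 b c g) (P1 a b f) = P1 a c (comp1 g f))
    (unitE : forall a, id1 (P0 a) = P1 a a (id1 a)) :
  (forall a b (f : cell1 a b), P2 a b f f (id2 f) = id2 (P1 a b f)) ->
  (forall a b (f g h : cell1 a b) (y : cell2 g h) (x : cell2 f g),
    P2 a b f h (vcomp y x) = vcomp (P2 a b g h y) (P2 a b f g x)) ->
  (forall a b c (g g' : cell1 b c) (f f' : cell1 a b)
      (y : cell2 g g') (x : cell2 f f'),
    vcomp (P2 a c _ _ (hcomp y x)) (eq2 (multE a b c g f)) =
    vcomp (eq2 (multE a b c g' f')) (hcomp (P2 b c g g' y) (P2 a b f f' x))) ->
  @is_pseudofunctor C D P0 P1 P2 (fun a b c g f => eq2 (multE a b c g f))
    (fun a => eq2 (unitE a)).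
Proof.
move=> P2id P2v P2h.
have P2eq a b (f g : cell1 a b) (e : f = g) :
    P2 a b f g (eq2 e) = eq2 (f_equal (P1 a b) e).
  by subst g; exact: P2id.
split=> // *; first exact: eq2_invertible.
- exact: eq2_invertible.
- rewrite P2eq hcomp_id2_eq2 hcomp_eq2_id2 !vcomp_eq2; exact: eq2_irrelevance.
- rewrite P2eq hcomp_eq2_id2 !vcomp_eq2; exact: eq2_irrelevance.
- rewrite P2eq hcomp_id2_eq2 !vcomp_eq2; exact: eq2_irrelevance.
Qed.

Lemma existT_inj_snd (T : Type) (P : T -> Type) (x : T) (u v : P x) :
  existT P x u = existT P x v -> u = v.
Proof.
move=> e; have := projT2_eq e.
by rewrite (Prop_irrelevance (projT1_eq e) erefl).
Qed.

(** A morphism packed with its ends, so that morphisms between objects that are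
only provably equal can be compared without transport. *)
Definition hom_total (k : fieldType) (C : prelin_cat k) (x y : C)
    (f : phom x y) :=
  existT (fun p : C * C => phom p.1 p.2 : Type) (x, y) f.

(** The packed identity morphisms already determine the values on objects. *)
Lemma linfunctor_ext (k : fieldType) (C D : prelin_cat k)
    (F F' : linfunctor C D) :
  (forall x y (f : phom x y),
     hom_total (lfmor F f) = hom_total (lfmor F' f)) -> F = F'.
Proof.
case: F F' => Fo Fm p [Fo' Fm' p'] /= E.
have eo : Fo = Fo'.
  by apply/funext => x; exact: (f_equal (fun s => (projT1 s).1) (E x x (pid x))).
subst Fo'; have em : Fm = Fm'.
  do 3!(apply: functional_extensionality_dep => ?).
  exact: (existT_inj_snd (E _ _ _)).
by subst Fm'; exact: linfunctor_eq.
Qed.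

End StrictFunctors.

(** * Translated representations and whiskered arrows *)

Section TranslatedReps.
Variables (R : realType) (k : fieldExtType R) (dG dH : nat).
Variables (G : lieGroupType R dG) (H : lieGroupType R dH).
Variable X : crossed_module G H.
Implicit Types (g x y z : G) (V W : rep_data k X).

Lemma smooth_bmap_trans g (V W : bundle k G) (f : forall x, 'Hom(V x, W x)) :
  smooth_bmap f ->
  smooth_bmap (V := trans_bundle g V) (W := trans_bundle g W)
    (fun x => f (x * g)%g).
Proof.
move=> fs s' t' p i j [s sV es] [t tW et]; subst s' t' => sp tp.
apply: (@ksmooth_comp _ _ _ _ _ _ _ (atlas G)
  (fun x => mxcoef s t (f x) i j) (fun x => x * g)%g).
- exact: atlas_charted.
- exact: atlas_charted.
- exact: rtrans_smooth.
- exact: fs.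
Qed.

Lemma trans_vbundle g (V : bundle k G) :
  is_vbundle V -> is_vbundle (trans_bundle g V).
Proof.
case=> Vo Vc Vb Vs; split.
- move=> _ [s sV <-] /=; apply: (@open_comp _ _ (fun x => x * g)%g).
    by move=> x _; exact: (rtrans_smooth g).1.
  exact: Vo.
- by move=> p; have [s sV sp] := Vc (p * g)%g; exists (trans_triv g s) => //; exists s.
- by move=> _ x [s sV <-] /= sx; exact: Vb.
- exact: (smooth_bmap_trans (f := fun x => \1%VF)).
Qed.

(** The target of [arrow_of] is [bd h * x], which for an arrow [a : x -> y] is only
provably equal to [y]; smoothness of [ract] is stated with the former, and is
used here with the latter. *)
Lemma mxcoef_ract V (s t : loc_triv V) x y (a : arrow X x y) i j :
  mxcoef s t (ract V (arrow_of X x (sval a))) i j = mxcoef s t (ract V a) i j.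
Proof. by case: a => h e; subst y. Qed.

Lemma trans_is_rep g V : is_rep V -> is_rep (trans_rep g V).
Proof.
case=> Vv Vb V1 VM Vs; split=> /=.
- exact: trans_vbundle.
- by move=> x y a; exact: Vb.
- by move=> x; rewrite -V1; congr (ract V _); exact: arrow_eq.
- by move=> x y z b a; rewrite -VM; congr (ract V _); exact: arrow_eq.
- move=> s' t' p i j [s sV es] [t tV et]; subst s' t' => sp tp.
  rewrite (_ : (fun q => _) = (fun q : G * H =>
      mxcoef s t (ract V (arrow_of X q.1 q.2)) i j) \o (fun q => (q.1 * g, q.2)%g)).
    apply: ksmooth_comp.
    - by apply: prod_charted; exact: atlas_charted.
    - by apply: prod_charted; exact: atlas_charted.
    - exact: rtrans_arrow_smooth.
    - by apply: Vs => //=; rewrite mulgA.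
  apply/funext => q /=.
  exact: (esym (mxcoef_ract (s := s) (t := t)
    (trans_arrow g (arrow_of X q.1 q.2)) i j)).
Qed.

Lemma trans_is_rmor g V W (f : forall x, 'Hom(V x, W x)) :
  is_rmor f ->
  is_rmor (V := trans_rep g V) (W := trans_rep g W) (fun x => f (x * g)%g).
Proof.
case=> fs fe; split; first exact: smooth_bmap_trans.
by move=> x y a; exact: fe.
Qed.

(** For [b = (x, h') : x -> y] equivariance reads
[alpha(y)^-1 h * h' = h' * alpha(x)^-1 h]. Since [y^-1 = x^-1 * (bd h')^-1], the
Peiffer identity makes the left factor the conjugate of [alpha(x)^-1 h] by [h']. *)
Lemma whisk_is_rmor g g' (a : arrow X g g') V : is_rep V ->
  is_rmor (V := trans_rep g V) (W := trans_rep g' V)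
    (fun x => ract V (whisk_arrow x a)).
Proof.
move=> Vr; split.
  move=> s' t' p i j [s sV es] [t tV et]; subst s' t' => /= sp tp.
  rewrite (_ : (fun x => _) = (fun q : G * H =>
      mxcoef s t (ract V (arrow_of X q.1 q.2)) i j) \o
      (fun x => (x * g, xact X x^-1 (sval a))%g)).
    apply: ksmooth_comp.
    - exact: atlas_charted.
    - by apply: prod_charted; exact: atlas_charted.
    - exact: whisk_smooth.
    - by apply: (ract_smooth Vr) => //=; rewrite (whisk_arrow_subproof p a).
  apply/funext => x.
  exact: (esym (mxcoef_ract (s := s) (t := t) (whisk_arrow x a) i j)).
move=> x y b /=; rewrite -!(ract_comp Vr); congr (ract V _); apply: arrow_eq => /=.
have -> : (y^-1 = x^-1 * bd X (sval b)^-1)%g by rewrite bdV -invgM (svalP b).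
by rewrite xact_mul peiffer invgK mulgVK.
Qed.

Definition castv (U W : vectType k) (e : U = W) : 'Hom(U, W) :=
  match e with erefl => \1%VF end.

(** An arrow with label [1] joins equal points, and once these are identified both
sides are the identity. *)
Lemma castv_ract V x y (e : V x = V y) (a : arrow X x y) :
  is_rep V -> sval a = 1%g -> castv e = ract V a.
Proof.
move=> Vr a1; have xy : x = y by rewrite -(svalP a) a1 bd1 mul1g.
subst y; rewrite (Prop_irrelevance e erefl) /= -(ract_id Vr).
by congr (ract V _); exact: arrow_eq.
Qed.

Lemma whisk_id g V x : is_rep V -> ract V (whisk_arrow x (arrow_id X g)) = \1%VF.
Proof.
move=> Vr; rewrite -(ract_id Vr); congr (ract V _).
by apply: arrow_eq; rewrite /= xactg1.
Qed.

Lemma whisk_vcomp g g' g'' (b : arrow X g' g'') (a : arrow X g g') V x :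
  is_rep V -> ract V (whisk_arrow x (arrow_vcomp b a)) =
    (ract V (whisk_arrow x b) \o ract V (whisk_arrow x a))%VF.
Proof.
move=> Vr; rewrite -(ract_comp Vr); congr (ract V _).
by apply: arrow_eq; rewrite /= xactM.
Qed.

(** On labels both sides are [alpha(x)^-1 (b * alpha(g)^-1 a)], the transports
contributing [1]; on the right [alpha(x g)^-1 a = alpha(x)^-1 (alpha(g)^-1 a)]. *)
Lemma whisk_hcomp g g1 g' g1' (b : arrow X g g1) (a : arrow X g' g1') V x
    (e : V (x * g * g')%g = V (x * (g * g'))%g)
    (e1 : V (x * g1 * g1')%g = V (x * (g1 * g1'))%g) :
  is_rep V ->
  (ract V (whisk_arrow x (arrow_hcomp b a)) \o castv e =
   castv e1 \o (ract V (trans_arrow g1' (whisk_arrow x b)) \o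
                ract V (whisk_arrow (x * g)%g a)))%VF.
Proof.
move=> Vr.
have xgg : (bd X 1 * (x * g * g') = x * (g * g'))%g by rewrite bd1 mul1g mulgA.
have xgg1 : (bd X 1 * (x * g1 * g1') = x * (g1 * g1'))%g by rewrite bd1 mul1g mulgA.
rewrite (castv_ract e (a := exist _ 1%g xgg)) //.
rewrite (castv_ract e1 (a := exist _ 1%g xgg1)) //.
rewrite -!(ract_comp Vr); congr (ract V _); apply: arrow_eq => /=.
by rewrite mulg1 mul1g xactM -xact_mul invgM.
Qed.

End TranslatedReps.

(** * Uniqueness of pullbacks *)

Section PulledBack.
Variables (R : realType) (k : fieldExtType R) (dG dH : nat).
Variables (G : lieGroupType R dG) (H : lieGroupType R dH).
Variable X : crossed_module G H.
Implicit Types (phi psi : G -> G) (V W : rep_data k X) (T U : trep_data k X).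

Definition pull_triv phi (V : G -> vectType k) (s : loc_triv V) :
    loc_triv (fun x => V (phi x)) :=
  {| ldom := [set x | ldom s (phi x)]; lrank := lrank s;
     lmap := fun x => lmap s (phi x) |}.

Arguments pull_triv phi {V} s.

(** [a] is [r] along the functor that has [phi] on objects and keeps labels. Only
the label of [b] is prescribed: it determines [b] once [phi] is fixed, and does
not mention how [phi] is written. *)
Definition pulled_act phi (fibre : G -> vectType k)
    (r : forall x y, arrow X x y -> 'Hom(fibre x, fibre y))
    (a : forall x y, arrow X x y -> 'Hom(fibre (phi x), fibre (phi y))) :=
  forall x y h, exists2 b : arrow X (phi x) (phi y),
    sval b = sval h & a x y h = r _ _ b.

Lemma pulled_act_uniq phi fibre r a a' :
  @pulled_act phi fibre r a -> @pulled_act phi fibre r a' -> a = a'.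
Proof.
move=> ra ra'; apply: functional_extensionality_dep => x.
apply: functional_extensionality_dep => y.
apply: functional_extensionality_dep => h.
have [b bh ->] := ra _ _ h; have [b' bh' ->] := ra' _ _ h.
by congr (r _ _ _); apply: arrow_eq; rewrite bh bh'.
Qed.

Definition rep_hom_data V W (f : forall x, 'Hom(V x, W x)) :=
  existT (fun p : rep_data k X * rep_data k X => forall x, 'Hom(p.1 x, p.2 x))
    (V, W) f.

Lemma rep_hom_data_inj (V W V' W' : Rep k X) (f : phom V W) (f' : phom V' W') :
  rep_hom_data (rmap f) = rep_hom_data (rmap f') -> hom_total f = hom_total f'.
Proof.
case: V W V' W' f f' => V pV [W pW] [V' pV'] [W' pW'] f f' /= E.
have [eV eW] := projT1_eq E; subst V' W'.
rewrite /hom_total (Prop_irrelevance pV' pV) (Prop_irrelevance pW' pW) in f' E *.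
congr existT; apply: rmor_eq => x.
by rewrite (existT_inj_snd E).
Qed.

Definition pulled_rep phi V t a : rep_data k X :=
  {| rbun := {| fib := fun x => V (phi x); triv := t |}; ract := a |}.

(** Identifying [phi] with [psi] makes both sides pullbacks along one map, and a
pullback is determined by that map. The trivializations and the actions are
parameters since iterated and trivial translations are not syntactically of the
form [trans_rep]. *)
Lemma pulled_rep_eq phi psi V W (f : forall x, 'Hom(V x, W x))
    tV aV tW aW tV' aV' tW' aW' :
  phi =1 psi ->
  tV = pull_triv phi @` triv V -> tW = pull_triv phi @` triv W ->
  tV' = pull_triv psi @` triv V -> tW' = pull_triv psi @` triv W ->
  pulled_act (@ract _ _ _ _ _ _ _ V) aV -> pulled_act (@ract _ _ _ _ _ _ _ W) aW ->
  pulled_act (@ract _ _ _ _ _ _ _ V) aV' -> pulled_act (@ract _ _ _ _ _ _ _ W) aW' ->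
  @rep_hom_data (@pulled_rep phi V tV aV) (@pulled_rep phi W tW aW)
    (fun x => f (phi x)) =
  @rep_hom_data (@pulled_rep psi V tV' aV') (@pulled_rep psi W tW' aW')
    (fun x => f (psi x)).
Proof.
move=> /funext e; subst psi => -> -> -> -> pV pW pV' pW'.
by rewrite (pulled_act_uniq pV pV') (pulled_act_uniq pW pW').
Qed.

Definition trep_hom_data T U (f : G -> 'Hom(tfib T, tfib U)) :=
  existT (fun p : trep_data k X * trep_data k X => G -> 'Hom(tfib p.1, tfib p.2))
    (T, U) f.

Lemma trep_hom_data_inj (T U T' U' : Rep_tr k X) (f : phom T U)
    (f' : phom T' U') :
  @trep_hom_data (sval T) (sval U) (rmap f) =
  @trep_hom_data (sval T') (sval U') (rmap f') ->
  hom_total f = hom_total f'.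
Proof.
case: T U T' U' f f' => V pV [W pW] [V' pV'] [W' pW'] f f' /= E.
have [eV eW] := projT1_eq E; subst V' W'.
rewrite /hom_total (Prop_irrelevance pV' pV) (Prop_irrelevance pW' pW) in f' E *.
congr existT; apply: rmor_eq => x.
by rewrite (existT_inj_snd E).
Qed.

Definition pulled_trep T a : trep_data k X := {| tfib := tfib T; tact := a |}.

Lemma pulled_trep_eq phi psi T U (f : G -> 'Hom(tfib T, tfib U)) aT aU aT' aU' :
  phi =1 psi ->
  @pulled_act phi (fun=> tfib T) (@tact _ _ _ _ _ _ _ T) aT ->
  @pulled_act phi (fun=> tfib U) (@tact _ _ _ _ _ _ _ U) aU ->
  @pulled_act psi (fun=> tfib T) (@tact _ _ _ _ _ _ _ T) aT' ->
  @pulled_act psi (fun=> tfib U) (@tact _ _ _ _ _ _ _ U) aU' ->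
  @trep_hom_data (pulled_trep aT) (pulled_trep aU) (fun x => f (phi x)) =
  @trep_hom_data (pulled_trep aT') (pulled_trep aU') (fun x => f (psi x)).
Proof.
move=> /funext e; subst psi => pT pU pT' pU'.
by rewrite (pulled_act_uniq pT pT') (pulled_act_uniq pU pU').
Qed.

End PulledBack.

(** * The 2-representation on all bundles *)

Section TranslationOnRep.
Variables (R : realType) (k : fieldExtType R) (dG dH : nat).
Variables (G : lieGroupType R dG) (H : lieGroupType R dH).
Variable X : crossed_module G H.
Implicit Types (g x y z : G).

(** The equality of fibres on the right is irrelevant for the value of [castv], so
this applies to whatever equality of fibres is at hand. *)
Lemma idtrans_rep (C : prelin_cat k) (F F' : linfunctor C (Rep k X))
    (e : F = F') (c : C) x :
  rmap (idtrans e c : rmor (sval (F c)) (sval (F' c))) x =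
  castv (f_equal (fun K : linfunctor C (Rep k X) => fib (sval (K c)) x) e).
Proof. by subst F'. Qed.

Definition trans_rep_ob g (V : Rep k X) : Rep k X :=
  mk_rep (trans_is_rep g (svalP V)).

Definition trans_rep_mor g (V W : Rep k X) (f : phom V W) :
    phom (trans_rep_ob g V) (trans_rep_ob g W) :=
  RMor (trans_is_rmor g (rmorP f)).

Lemma trans_rep_linfunctor g : is_linfunctor (@trans_rep_mor g).
Proof. by split=> [V W a u v|V|V W U w f]; apply: rmor_eq. Qed.

Definition trans_rep_functor g : linfunctor (Rep k X) (Rep k X) :=
  LinFunctor (trans_rep_linfunctor g).

Lemma trans_rep_mult g g' :
  linfunctor_comp (trans_rep_functor g) (trans_rep_functor g') =
  trans_rep_functor (g * g')%g.
Proof.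
apply: linfunctor_ext => V W f; apply: rep_hom_data_inj.
apply: (@pulled_rep_eq _ _ _ _ _ _ X (fun x => x * g * g')%g
   (fun x => x * (g * g'))%g (sval V) (sval W) (rmap f)) => //=.
- by move=> x; rewrite mulgA.
- by rewrite image_comp.
- by rewrite image_comp.
- by move=> x y h; exists (trans_arrow g' (trans_arrow g h)).
- by move=> x y h; exists (trans_arrow g' (trans_arrow g h)).
- by move=> x y h; exists (trans_arrow (g * g')%g h).
- by move=> x y h; exists (trans_arrow (g * g')%g h).
Qed.

Lemma trans_rep_unit : linfunctor_id (Rep k X) = trans_rep_functor 1%g.
Proof.
apply: linfunctor_ext => V W f; apply: rep_hom_data_inj.
case: V W f => [[[fV tV] aV] pV] [[[fW tW] aW] pW] /= f.
apply: (@pulled_rep_eq _ _ _ _ _ _ X id (fun x => x * 1)%g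
  {| rbun := {| fib := fV; triv := tV |}; ract := aV |}
  {| rbun := {| fib := fW; triv := tW |}; ract := aW |} (rmap f)) => //=.
- by move=> x; rewrite mulg1.
- by rewrite -[LHS]image_id; apply: eq_imagel => -[].
- by rewrite -[LHS]image_id; apply: eq_imagel => -[].
- by move=> x y h; exists h.
- by move=> x y h; exists h.
- by move=> x y h; exists (trans_arrow 1%g h).
- by move=> x y h; exists (trans_arrow 1%g h).
Qed.

Definition whisk_rep g g' (a : arrow X g g') (V : Rep k X) :
    phom (trans_rep_functor g V) (trans_rep_functor g' V) :=
  RMor (whisk_is_rmor a (svalP V)).

Lemma whisk_rep_nat g g' (a : arrow X g g') : is_nattrans (whisk_rep a).
Proof.
by move=> V W f; apply: rmor_eq => x /=; rewrite ((rmorP f).2 _ _ (whisk_arrow x a)).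
Qed.

Definition whisk_rep_trans g g' (a : arrow X g g') :
    nattrans (trans_rep_functor g) (trans_rep_functor g') :=
  NatTrans (whisk_rep_nat a).

Lemma trans_rep_pseudofunctor :
  @is_pseudofunctor (BG X) (twoVect k) (fun=> Rep k X)
    (fun _ _ => trans_rep_functor) (fun _ _ => whisk_rep_trans)
    (fun _ _ _ g g' => idtrans (trans_rep_mult g g'))
    (fun _ => idtrans trans_rep_unit).
Proof.
apply: (@strict_pseudofunctor (BG X) (twoVect k) (fun=> Rep k X)
  (fun _ _ => trans_rep_functor) (fun _ _ => whisk_rep_trans)
  (fun _ _ _ => trans_rep_mult) (fun=> trans_rep_unit)).
- move=> [] [] g; apply: nattrans_eq => V; apply: rmor_eq => x.
  exact: whisk_id (svalP V).
- move=> [] [] g g' g'' b a; apply: nattrans_eq => V; apply: rmor_eq => x.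
  exact: whisk_vcomp (svalP V).
- move=> [] [] [] g g1 g' g1' b a; apply: nattrans_eq => V; apply: rmor_eq => x.
  have := idtrans_rep (trans_rep_mult g g') V x.
  have := idtrans_rep (trans_rep_mult g1 g1') V x.
  rewrite /idtrans /= => -> ->.
  exact: whisk_hcomp (svalP V).
Qed.

End TranslationOnRep.

(** * The 2-representation on trivial bundles *)

Section TranslationOnTrivialRep.
Variables (R : realType) (k : fieldExtType R) (dG dH : nat).
Variables (G : lieGroupType R dG) (H : lieGroupType R dH).
Variable X : crossed_module G H.
Implicit Types (g x y z : G) (T U : trep_data k X).

Lemma trans_triv_const g (V : vectType k) :
  trans_triv g @` triv (triv_bundle G V) = triv (triv_bundle G V).
Proof.
apply/seteqP; split.
  by move=> _ [_ [r [L [Lb ->]]] <-]; exists r, L.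
move=> _ [r [L [Lb ->]]].
by exists {| ldom := setT; lrank := r; lmap := fun=> L |} => //; exists r, L.
Qed.

Lemma rep_of_trans_trep g T :
  trans_rep g (rep_of_trep T) = rep_of_trep (trans_trep g T).
Proof.
exact: (f_equal (fun t => {| rbun := {| fib := fun=> tfib T; triv := t |};
  ract := tact (trans_trep g T) |} : rep_data k X) (trans_triv_const g (tfib T))).
Qed.

Lemma trans_trep_is_rep g T :
  is_rep (rep_of_trep T) -> is_rep (rep_of_trep (trans_trep g T)).
Proof. by rewrite -rep_of_trans_trep; exact: trans_is_rep. Qed.

(** [rep_of_trans_trep] in the form needed for families of maps: rewriting with that
equality would transport the family as well, although its type is unchanged. *)
Lemma trans_trep_is_rmor g g' T U (f : G -> 'Hom(tfib T, tfib U)) :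
  is_rmor (V := trans_rep g (rep_of_trep T))
    (W := trans_rep g' (rep_of_trep U)) f ->
  is_rmor (V := rep_of_trep (trans_trep g T))
    (W := rep_of_trep (trans_trep g' U)) f.
Proof.
case=> fs fe; split; last exact: fe.
move=> s t p i j sT tU; apply: fs.
  exact: (eq_ind_r (fun A : set _ => A s) sT (trans_triv_const g (tfib T))).
exact: (eq_ind_r (fun A : set _ => A t) tU (trans_triv_const g' (tfib U))).
Qed.

Lemma idtrans_trep (C : prelin_cat k) (F F' : linfunctor C (Rep_tr k X))
    (e : F = F') (c : C) x :
  rmap (idtrans e c :
    rmor (rep_of_trep (sval (F c))) (rep_of_trep (sval (F' c)))) x =
  castv (f_equal (fun K : linfunctor C (Rep_tr k X) => tfib (sval (K c))) e).
Proof. by subst F'. Qed.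

Definition trans_trep_ob g (T : Rep_tr k X) : Rep_tr k X :=
  mk_trep (trans_trep_is_rep g (svalP T)).

Definition trans_trep_mor g (T U : Rep_tr k X) (f : phom T U) :
    phom (trans_trep_ob g T) (trans_trep_ob g U) :=
  RMor (trans_trep_is_rmor (trans_is_rmor g (rmorP f))).

Lemma trans_trep_linfunctor g : is_linfunctor (@trans_trep_mor g).
Proof. by split=> [T U a u v|T|T U W w f]; apply: rmor_eq. Qed.

Definition trans_trep_functor g : linfunctor (Rep_tr k X) (Rep_tr k X) :=
  LinFunctor (trans_trep_linfunctor g).

Lemma trans_trep_mult g g' :
  linfunctor_comp (trans_trep_functor g) (trans_trep_functor g') =
  trans_trep_functor (g * g')%g.
Proof.
apply: linfunctor_ext => T U f; apply: trep_hom_data_inj.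
apply: (@pulled_trep_eq _ _ _ _ _ _ X (fun x => x * g * g')%g
   (fun x => x * (g * g'))%g (sval T) (sval U) (rmap f)) => //=.
- by move=> x; rewrite mulgA.
- by move=> x y h; exists (trans_arrow g' (trans_arrow g h)).
- by move=> x y h; exists (trans_arrow g' (trans_arrow g h)).
- by move=> x y h; exists (trans_arrow (g * g')%g h).
- by move=> x y h; exists (trans_arrow (g * g')%g h).
Qed.

Lemma trans_trep_unit : linfunctor_id (Rep_tr k X) = trans_trep_functor 1%g.
Proof.
apply: linfunctor_ext => T U f; apply: trep_hom_data_inj.
case: T U f => [[fT aT] pT] [[fU aU] pU] /= f.
apply: (@pulled_trep_eq _ _ _ _ _ _ X id (fun x => x * 1)%g
  {| tfib := fT; tact := aT |} {| tfib := fU; tact := aU |} (rmap f)) => //=.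
- by move=> x; rewrite mulg1.
- by move=> x y h; exists h.
- by move=> x y h; exists h.
- by move=> x y h; exists (trans_arrow 1%g h).
- by move=> x y h; exists (trans_arrow 1%g h).
Qed.

Definition whisk_trep g g' (a : arrow X g g') (T : Rep_tr k X) :
    phom (trans_trep_functor g T) (trans_trep_functor g' T) :=
  RMor (trans_trep_is_rmor (whisk_is_rmor a (svalP T))).

Lemma whisk_trep_nat g g' (a : arrow X g g') : is_nattrans (whisk_trep a).
Proof.
move=> T U f; apply: rmor_eq => x.
exact: (esym ((rmorP f).2 _ _ (whisk_arrow x a))).
Qed.

Definition whisk_trep_trans g g' (a : arrow X g g') :
    nattrans (trans_trep_functor g) (trans_trep_functor g') :=
  NatTrans (whisk_trep_nat a).

Lemma trans_trep_pseudofunctor :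
  @is_pseudofunctor (BG X) (twoVect k) (fun=> Rep_tr k X)
    (fun _ _ => trans_trep_functor) (fun _ _ => whisk_trep_trans)
    (fun _ _ _ g g' => idtrans (trans_trep_mult g g'))
    (fun _ => idtrans trans_trep_unit).
Proof.
apply: (@strict_pseudofunctor (BG X) (twoVect k) (fun=> Rep_tr k X)
  (fun _ _ => trans_trep_functor) (fun _ _ => whisk_trep_trans)
  (fun _ _ _ => trans_trep_mult) (fun=> trans_trep_unit)).
- move=> [] [] g; apply: nattrans_eq => T; apply: rmor_eq => x.
  exact: whisk_id (svalP T).
- move=> [] [] g g' g'' b a; apply: nattrans_eq => T; apply: rmor_eq => x.
  exact: whisk_vcomp (svalP T).
- move=> [] [] [] g g1 g' g1' b a; apply: nattrans_eq => T; apply: rmor_eq => x.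
  have := idtrans_trep (trans_trep_mult g g') T x.
  have := idtrans_trep (trans_trep_mult g1 g1') T x.
  rewrite /idtrans /= => -> ->.
  exact: whisk_hcomp (svalP T).
Qed.

End TranslationOnTrivialRep.

(** * The two 2-representations *)

Theorem corollary3 (R : realType) (k : fieldExtType R) (dG dH : nat)
    (G : lieGroupType R dG) (H : lieGroupType R dH) (X : crossed_module G H) :
  (exists (obP : forall (g : G) (V : rep k X), is_rep (trans_rep g (sval V)))
     (morP : forall (g : G) (V W : rep k X) (f : rmor (sval V) (sval W)),
        is_rmor (V := trans_rep g (sval V)) (W := trans_rep g (sval W))
          (fun x => f (x * g)%g)),
   let Fob (g : G) (V : Rep k X) : Rep k X := mk_rep (obP g V) in
   let Fmor (g : G) (V W : Rep k X) (f : phom V W) :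
       phom (Fob g V) (Fob g W) := RMor (morP g V W f) in
   exists funP : forall g : G, is_linfunctor (Fmor g),
   let F1 (g : G) : linfunctor (Rep k X) (Rep k X) := LinFunctor (funP g) in
   exists compP : forall (g g' : G) (a : arrow X g g') (V : rep k X),
     is_rmor (V := trans_rep g (sval V)) (W := trans_rep g' (sval V))
       (fun x => ract (sval V) (whisk_arrow x a)),
   let Fcomp (g g' : G) (a : arrow X g g') (V : Rep k X) :
       phom (F1 g V) (F1 g' V) := RMor (compP g g' a V) in
   exists natP : forall (g g' : G) (a : arrow X g g'),
     is_nattrans (Fcomp g g' a),
   let F2 (g g' : G) (a : arrow X g g') : nattrans (F1 g) (F1 g') :=
     NatTrans (natP g g' a) in
   exists (multE : forall g g' : G,
       linfunctor_comp (F1 g) (F1 g') = F1 (g * g')%g)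
     (unitE : linfunctor_id (Rep k X) = F1 1%g),
   @is_pseudofunctor (BG X) (twoVect k) (fun=> Rep k X)
     (fun _ _ => F1) (fun _ _ => F2)
     (fun _ _ _ g g' => idtrans (multE g g')) (fun _ => idtrans unitE)) /\
  (exists (obP : forall (g : G) (T : trep k X),
       is_rep (rep_of_trep (trans_trep g (sval T))))
     (morP : forall (g : G) (T U : trep k X)
         (f : rmor (rep_of_trep (sval T)) (rep_of_trep (sval U))),
        is_rmor (V := rep_of_trep (trans_trep g (sval T)))
          (W := rep_of_trep (trans_trep g (sval U))) (fun x => f (x * g)%g)),
   let Fob (g : G) (T : Rep_tr k X) : Rep_tr k X := mk_trep (obP g T) in
   let Fmor (g : G) (T U : Rep_tr k X) (f : phom T U) :
       phom (Fob g T) (Fob g U) := RMor (morP g T U f) in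
   exists funP : forall g : G, is_linfunctor (Fmor g),
   let F1 (g : G) : linfunctor (Rep_tr k X) (Rep_tr k X) :=
     LinFunctor (funP g) in
   exists compP : forall (g g' : G) (a : arrow X g g') (T : trep k X),
     is_rmor (V := rep_of_trep (trans_trep g (sval T)))
       (W := rep_of_trep (trans_trep g' (sval T)))
       (fun x => tact (sval T) (whisk_arrow x a)),
   let Fcomp (g g' : G) (a : arrow X g g') (T : Rep_tr k X) :
       phom (F1 g T) (F1 g' T) := RMor (compP g g' a T) in
   exists natP : forall (g g' : G) (a : arrow X g g'),
     is_nattrans (Fcomp g g' a),
   let F2 (g g' : G) (a : arrow X g g') : nattrans (F1 g) (F1 g') :=
     NatTrans (natP g g' a) in
   exists (multE : forall g g' : G,
       linfunctor_comp (F1 g) (F1 g') = F1 (g * g')%g)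
     (unitE : linfunctor_id (Rep_tr k X) = F1 1%g),
   @is_pseudofunctor (BG X) (twoVect k) (fun=> Rep_tr k X)
     (fun _ _ => F1) (fun _ _ => F2)
     (fun _ _ _ g g' => idtrans (multE g g')) (fun _ => idtrans unitE)).
Proof.
split.
  exists (fun g V => trans_is_rep g (svalP V)).
  exists (fun g V W f => trans_is_rmor g (rmorP f)).
  exists (@trans_rep_linfunctor _ _ _ _ _ _ X).
  exists (fun g g' a V => whisk_is_rmor a (svalP V)).
  exists (@whisk_rep_nat _ _ _ _ _ _ X).
  exists (@trans_rep_mult _ _ _ _ _ _ X), (@trans_rep_unit _ _ _ _ _ _ X).
  exact: trans_rep_pseudofunctor.
exists (fun g T => trans_trep_is_rep g (svalP T)).
exists (fun g T U f => trans_trep_is_rmor (trans_is_rmor g (rmorP f))).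
exists (@trans_trep_linfunctor _ _ _ _ _ _ X).
exists (fun g g' a T => trans_trep_is_rmor (whisk_is_rmor a (svalP T))).
exists (@whisk_trep_nat _ _ _ _ _ _ X).
exists (@trans_trep_mult _ _ _ _ _ _ X), (@trans_trep_unit _ _ _ _ _ _ X).
exact: trans_trep_pseudofunctor.
Qed.
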